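(* Let $\alpha \in (0,1)$, let $\mathcal{H} = (\mathcal{H}_n)_{n \in \mathbb{N}}$ be a sequence of $3$-uniform hypergraphs with $|V(\mathcal{H}_n)| = n$, and let $\mathcal{B} = (\mathcal{B}_n)_{n\in\mathbb{N}}$, where each $\mathcal{B}_n$ is a family of subsets of $V(\mathcal{H}_n)$. Suppose that $\mathcal{H}$ is $(\alpha,\mathcal{B})$-stable, that $e(\mathcal{H}_n) = \Theta(n^2)$ and $\Delta_2(\mathcal{H}_n) = O(1)$, that $|\mathcal{B}_n| = n^{O(1)}$, that $\alpha(\mathcal{H}_n) \geqslant \|\mathcal{B}_n\| \geqslant \alpha n$, and that $\delta(\mathcal{H}_n,\mathcal{B}_n) = \Omega(n)$. Then there exists a constant $C = C(\mathcal{H},\mathcal{B}) > 0$ such that if $m \geqslant C\sqrt{n\log n}$, then almost every independent set in $\mathcal{H}_n$ of size $m$ is a subset of some $B \in \mathcal{B}_n$; that is, for any choice of $m = m(n) \geqslant C\sqrt{n \log n}$, the proportion of independent sets of size $m$ in $\mathcal{H}_n$ that are contained in some $B \in \mathcal{B}_n$ tends to $1$ as $n \to \infty$.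
   Context: $|\mathcal{B}_n|$ is the number of sets in $\mathcal{B}_n$ and $\|\mathcal{B}_n\| = \max\{|B| : B \in \mathcal{B}_n\}$. The sequence $\mathcal{H}$ is $(\alpha,\mathcal{B})$-stable if for every $\gamma > 0$ there exists $\beta > 0$ such that for every $n$ and every $A \subseteq V(\mathcal{H}_n)$ with $|A| \geqslant (\alpha-\beta)n$, either $e(\mathcal{H}_n[A]) \geqslant \beta\, e(\mathcal{H}_n)$, or $|A \setminus B| \leqslant \gamma n$ for some $B \in \mathcal{B}_n$. Here $e(\cdot)$ is the number of edges and $\mathcal{H}_n[A]$ the induced subhypergraph. $\Delta_2(\mathcal{H}_n) = \max_{T \subseteq V(\mathcal{H}_n), |T|=2} |\{e \in \mathcal{H}_n : T \subseteq e\}|$. $\delta(\mathcal{H}_n,\mathcal{B}_n) = \min_{B \in \mathcal{B}_n}\min_{v \in V(\mathcal{H}_n)\setminus B} |\{e \in \mathcal{H}_n : |e \cap B| = 2, v \in e\}|$. An independent set is a vertex set containing no edge, and $\alpha(\mathcal{H}_n)$ is the maximum size of an independent set. Asymptotic notation ($\Theta, O, \Omega$) refers to $n \to \infty$ with constants independent of $n$. $\log$ is the natural logarithm. *)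

(* Defs.v *)
From mathcomp Require Import all_boot.
From Stdlib Require Import Reals.
Set Implicit Arguments. Unset Strict Implicit. Unset Printing Implicit Defensive.

Definition hgraph (n : nat) := {set {set 'I_n}}.

Definition uniform3 n (H : hgraph n) : Prop := forall e, e \in H -> #|e| = 3.

Definition nedges n (H : hgraph n) : nat := #|H|.
Definition nedges_ind n (H : hgraph n) (A : {set 'I_n}) : nat :=
  #|[set e in H | e \subset A]|.

Definition independent n (H : hgraph n) (A : {set 'I_n}) : bool :=
  [forall e in H, ~~ (e \subset A)].

Definition indep_number n (H : hgraph n) : nat :=
  \max_(A : {set 'I_n} | independent H A) #|A|.

Definition codeg n (H : hgraph n) (T : {set 'I_n}) : nat :=
  #|[set e in H | T \subset e]|.
Definition Delta2 n (H : hgraph n) : nat :=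
  \max_(T : {set 'I_n} | #|T| == 2) codeg H T.

Definition fam_card n (B : {set {set 'I_n}}) : nat := #|B|.
Definition fam_norm n (B : {set {set 'I_n}}) : nat := \max_(X in B) #|X|.

Definition deg_into n (H : hgraph n) (X : {set 'I_n}) (v : 'I_n) : nat :=
  #|[set e in H | (#|e :&: X| == 2) && (v \in e)]|.

Definition stable (alpha : R) (H : forall n, hgraph n)
  (B : forall n, {set {set 'I_n}}) : Prop :=
  forall gamma : R, (0 < gamma)%R ->
  exists beta : R, (0 < beta)%R /\
  forall (n : nat) (A : {set 'I_n}),
    ((alpha - beta) * INR n <= INR #|A|)%R ->
    (beta * INR (nedges (H n)) <= INR (nedges_ind (H n) A))%R \/
    (exists2 X, X \in B n & (INR #|A :\: X| <= gamma * INR n)%R).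

Definition indep_sets n (H : hgraph n) (m : nat) : {set {set 'I_n}} :=
  [set A : {set 'I_n} | independent H A && (#|A| == m)].
Definition good_indep_sets n (H : hgraph n) (B : {set {set 'I_n}}) (m : nat)
  : {set {set 'I_n}} :=
  [set A in indep_sets H m | [exists X in B, A \subset X]].

(* proportion; by convention 1 when there is no independent set of size m
   (then "almost every independent set" holds vacuously) *)
Definition good_proportion n (H : hgraph n) (B : {set {set 'I_n}}) (m : nat) : R :=
  if #|indep_sets H m| == 0 then 1%R
  else (INR #|good_indep_sets H B m| / INR #|indep_sets H m|)%R.

(* Main.v *)
(* Put [b = ||B_n||], so that there are at least [C(b, m)] independent sets of size [m],
   and [y = m / (b - m + 1)], for which [C(b, m) y ^ m >= (1 + y) ^ b / (b + 1)]: it is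
   enough to bound families of [m]-sets weighted by [y ^ m], and a weighted family is
   counted by deciding its members one vertex at a time.

   If [m > b - c0 n], stability puts all but few vertices of an independent [m]-set [I]
   into some [B]. A vertex of [I] outside [B] has [Omega(n)] edges into [B], each missing
   a vertex of [I], which makes [I] smaller than [b - c0 n]; hence [I] is inside [B].

   If [m <= b - c0 n], a set that is far from every [B] is handled by a container
   argument: after selecting only [O(sqrt n)] vertices, the undecided vertices span few
   edges, so by stability either there are fewer than [(alpha - beta) n] of them or they
   almost lie in some [B]; both leave an exponentially small proportion. A set [I] with
   [1 <= k <= delta m] vertices [U] outside [B] avoids the [Omega(k n)] pairs of [B] that
   form an edge with a vertex of [U]. Deciding [B] vertex by vertex, each selection kills
   [Omega(k)] vertices, which costs a factor [exp (- Omega(min(m, k m^2 / n)))]. As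
   [m^2 / n >= C^2 ln n], this beats the number of choices of [U] and of [B]. *)
Require Import Defs.
From mathcomp Require Import all_boot zify.
From Stdlib Require Import Reals Lra Lia.
Set Implicit Arguments. Unset Strict Implicit. Unset Printing Implicit Defensive.

(** * Containers *)

Lemma card_bigcup_le (I T : finType) (P : pred I) (F : I -> {set T}) :
  #|\bigcup_(i | P i) F i| <= \sum_(i | P i) #|F i|.
Proof.
elim/big_rec2: _ => [|i s U _ leUs]; first by rewrite cards0.
by apply: leq_trans (leq_card_setU _ _) _; rewrite leq_add2l.
Qed.

Lemma disjointsU (T : finType) (A B C : {set T}) :
  [disjoint A & C] -> [disjoint B & C] -> [disjoint A :|: B & C].
Proof. by rewrite !disjoints_subset subUset => -> ->. Qed.

Definition edeg n (E : hgraph n) (v : 'I_n) : nat := #|[set e in E | v \in e]|.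

Lemma card_le_sum_edeg n (E : hgraph n) (A : {set 'I_n}) :
  (forall e, e \in E -> exists2 v, v \in A & v \in e) ->
  #|E| <= \sum_(v in A) edeg E v.
Proof.
move=> coverE; apply: leq_trans (card_bigcup_le _ _); apply/subset_leq_card.
apply/subsetP=> e Ee; have [v Av ev] := coverE e Ee.
by apply/bigcupP; exists v => //; rewrite inE Ee.
Qed.

Lemma codeg_le_Delta2 n (H : hgraph n) (K : nat) u v :
  Delta2 H <= K -> u != v -> #|[set e in H | (u \in e) && (v \in e)]| <= K.
Proof.
move=> leK neq_uv; apply: leq_trans leK.
apply: leq_trans (leq_bigmax_cond [set u; v] _); last by rewrite cards2 neq_uv.
by apply/subset_leq_card/subsetP=> e; rewrite !inE subUset !sub1set.
Qed.

Definition nbrs n (E : hgraph n) (A : {set 'I_n}) (v : 'I_n) : {set 'I_n} :=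
  [set w in A | (w != v) && [exists e in E, (v \in e) && (w \in e)]].

(** Each edge through [v] has a further vertex in [A], and [v] shares at most [K] edges with any one
    vertex. This is how bounded codegree turns a large degree into many distinct neighbours. *)
Lemma edeg_le_nbrs n (H E : hgraph n) (K : nat) A v :
  Delta2 H <= K -> E \subset H ->
  (forall e, e \in E -> v \in e -> exists2 w, w \in A :\ v & w \in e) ->
  edeg E v <= #|nbrs E A v| * K.
Proof.
move=> leK sEH covA.
apply: (@leq_trans (\sum_(w in nbrs E A v) #|[set e in H | (v \in e) && (w \in e)]|)).
  apply: leq_trans (card_bigcup_le _ _); apply/subset_leq_card/subsetP=> e.
  rewrite inE => /andP[Ee ve]; have [w /setD1P[neq_wv Aw] we] := covA e Ee ve.
  apply/bigcupP; exists w; last by rewrite inE (subsetP sEH) // ve.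
  by rewrite inE Aw neq_wv; apply/existsP; exists e; rewrite Ee ve.
rewrite -sum_nat_const; apply: leq_sum => w; rewrite inE => /and3P[_ neq_wv _].
by apply: codeg_le_Delta2; rewrite // eq_sym.
Qed.

Section Container.

Variables (n : nat) (H : hgraph n) (K tau d : nat).
(** [G Y N] stands for a claim about the independent sets that contain [Y] and miss [N]. Keeping it
    abstract separates the selection procedure from the bound carried along it: a claim may be
    proved by branching on a vertex, is free once an edge is selected, and has to be checked where
    the procedure stops. *)
Variable G : {set 'I_n} -> {set 'I_n} -> Prop.
Hypothesis H3 : uniform3 H.
Hypothesis H_Delta2 : Delta2 H <= K.
Hypothesis G_split : forall (Y N : {set 'I_n}) v,
  v \notin Y -> v \notin N -> G (v |: Y) N -> G Y (v |: N) -> G Y N.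
Hypothesis G_edge : forall (Y N e : {set 'I_n}), e \in H -> e \subset Y -> G Y N.
Hypothesis G_leaf : forall W W1 N : {set 'I_n},
  [disjoint W :|: W1 & N] -> #|W| * d <= n * (tau + K) -> #|W1| * tau <= n * K ->
  nedges_ind H (~: (W :|: W1 :|: N)) <= n * d -> G (W :|: W1) N.

(** Selecting a vertex of [S] on top of [Y] settles the claim, so in a branching on such a vertex
    only the rejecting branch matters; the vertices of [S] are thus rejected one at a time. *)
Lemma G_forced (Y N S : {set 'I_n}) :
  (forall w N', w \in S -> G (w |: Y) N') -> [disjoint S & Y] ->
  G Y (S :|: N) -> G Y N.
Proof.
elim: {S}#|S| {-2}S (erefl #|S|) N => [|k IH] S cardS N forcedS disSY.
  by move/eqP: cardS; rewrite cards_eq0 => /eqP->; rewrite set0U.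
have [w Sw] : exists w, w \in S by apply/card_gt0P; rewrite cardS.
have cardSw : #|S :\ w| = k by move: cardS; rewrite (cardsD1 w S) Sw => -[].
move=> GS; have Yw: w \notin Y by rewrite (disjointFr disSY Sw).
have [Nw|Nw] := boolP (w \in N).
  apply: (IH (S :\ w)) => //.
  - by move=> u N' /setD1P[_ Su]; apply: forcedS.
  - by apply: disjointWl disSY; apply: subsetDl.
  - suff -> : S :\ w :|: N = S :|: N by [].
    by apply/setP=> u; rewrite !inE; case: eqP => // ->; rewrite Nw !orbT.
apply: (G_split Yw Nw); first exact: forcedS.
apply: (IH (S :\ w)) => //.
- by move=> u N' /setD1P[_ Su]; apply: forcedS.
- by apply: disjointWl disSY; apply: subsetDl.
- suff -> : S :\ w :|: (w |: N) = S :|: N by [].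
  by apply/setP=> u; rewrite !inE; case: eqP => //= ->; rewrite Sw.
Qed.

(** With [W] selected and [D] decided too, the other two vertices of such an edge are undecided.
    These edges act as a graph on the undecided vertices, whose pairs must not be selected
    together. *)
Definition xedges (W D : {set 'I_n}) : hgraph n :=
  [set e in H | (#|e :&: W| == 1) && [disjoint e & D]].

Lemma xedges_sub W D : xedges W D \subset H.
Proof. by apply/subsetP=> e; rewrite inE => /andP[]. Qed.

Lemma xedges_two W D e v : e \in xedges W D -> v \notin W ->
  exists2 w, w \in (~: (W :|: D)) :\ v & w \in e.
Proof.
rewrite inE => /and3P[He /eqP eW eD] Wv.
have : 0 < #|(e :\: W) :\ v|.
  have := cardsID W e; rewrite eW (H3 He) => /eqP; rewrite eqn_add2l => /eqP.
  by rewrite (cardsD1 v); case: (v \in _) => /=; lia.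
case/card_gt0P=> w; rewrite !inE => /and3P[nwv nWw ew]; exists w => //.
by rewrite !inE nwv negb_or nWw /= (disjointFr eD ew).
Qed.

(** Only edges meeting [S] are lost, at most [m] for each of its vertices. In the potential
    inequality of [container_state] the growth of [#|W1 :|: N|] pays for this loss. *)
Lemma xedges_grow W D (S : {set 'I_n}) m :
  (forall v, v \in S -> edeg (xedges W D) v <= m) ->
  #|xedges W D| <= #|xedges W (S :|: D)| + #|S| * m.
Proof.
move=> degS.
apply: (@leq_trans (#|xedges W (S :|: D)| + \sum_(v in S) edeg (xedges W D) v)).
  apply: leq_trans (leq_add (leqnn _) (card_bigcup_le _ _)).
  apply: leq_trans (leq_card_setU _ _).
  apply/subset_leq_card/subsetP=> e Xe; rewrite inE.
  have [dis|] := boolP [disjoint e & S].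
    move: Xe; rewrite !inE => /and3P[-> -> eD] /=.
    by rewrite disjoint_sym disjointsU // disjoint_sym.
  rewrite disjoint_sym => /pred0Pn[v /andP[/= Sv ev]]; apply/orP; right.
  by apply/bigcupP; exists v => //; rewrite inE Xe.
by rewrite leq_add2l -sum_nat_const; apply: leq_sum.
Qed.

Lemma edeg_xedges_grow W D S v :
  edeg (xedges W (S :|: D)) v <= edeg (xedges W D) v.
Proof.
apply/subset_leq_card/subsetP=> e; rewrite !inE => /andP[/and3P[-> -> dis] ->].
by rewrite andbT /=; apply: disjointWr dis; apply: subsetUr.
Qed.

(* Two kinds of selected vertices: those of [W1] had large degree in
   [xedges W D] and killed many neighbours, so there are at most [n K / tau];
   those of [W] had degree at least [d], so each one makes [xedges W D] larger
   by about [d], while no vertex ever has degree above [tau + K] in it. *)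
Lemma container_state (W W1 N : {set 'I_n}) :
  [disjoint W & W1] -> [disjoint W :|: W1 & N] ->
  (forall v, v \notin W :|: (W1 :|: N) ->
     edeg (xedges W (W1 :|: N)) v <= tau + K) ->
  #|W| * d <= #|xedges W (W1 :|: N)| + (#|W| + #|W1 :|: N|) * (tau + K) ->
  #|W1| * tau <= #|N| * K ->
  G (W :|: W1) N.
Proof.
have [k] := ubnP #|~: (W :|: (W1 :|: N))|.
elim: k => // k IH in W W1 N *; rewrite ltnS => cardA disW disN degX potX potN.
set D := W1 :|: N in cardA degX potX; set A := ~: (W :|: D) in cardA.
have inA v : (v \in A) = [&& v \notin W, v \notin W1 & v \notin N].
  by rewrite !inE !negb_or.
(* Rejecting an undecided vertex preserves all invariants, so in both branching cases only the
   selecting branch needs work. *)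
have no_branch v : v \in A -> G (W :|: W1) (v |: N).
  move=> Av; have := Av; rewrite inA => /and3P[nW nW1 nN].
  have eqD : W1 :|: (v |: N) = v |: D by rewrite setUCA.
  apply: IH => //.
  - apply: leq_trans cardA; apply/proper_card/properP; split.
      by rewrite eqD setCS; apply: setUS; apply: subsetUr.
    by exists v => //; rewrite eqD !inE eqxx !orbT.
  - by rewrite disjoint_sym disjointsU // ?disjoints1 1?disjoint_sym // inE negb_or nW.
  - rewrite eqD => u nu; apply: leq_trans (edeg_xedges_grow _ _ _ _) _.
    apply: degX; apply: contra nu; rewrite !inE => /orP[->//|/orP[]->];
    by rewrite !orbT.
  - have grow : forall u, u \in [set v] -> edeg (xedges W D) u <= tau + K.
      by move=> u; rewrite inE => /eqP->; apply: degX; move: Av; rewrite inE.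
    have := xedges_grow grow; rewrite eqD cards1 cardsU1.
    have -> : v \notin D by rewrite inE negb_or nW1.
    by move: potX; rewrite /=; nia.
  - by apply: leq_trans potN _; rewrite leq_mul2r cardsU1 leq_addl orbT.
have Y_v v : v \in A -> v \notin W :|: W1.
  by rewrite inA => /and3P[? ? _]; rewrite inE negb_or; apply/andP.
have N_v v : v \in A -> v \notin N by rewrite inA => /and3P[].
(* First case: [v] has degree at least [tau] in [xedges W D]. If selected it joins [W1], and its
   neighbours [S], at least [tau / K] of them, are forced into [N]. *)
have [/existsP[v /andP[Av deg_v]]|] :=
  boolP [exists v in A, tau <= edeg (xedges W D) v].
  have := Av; rewrite inA => /and3P[nW nW1 nN].
  apply: (G_split (Y_v v Av) (N_v v Av)); last exact: no_branch.
  pose S := nbrs (xedges W D) A v.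
  have S_A w : w \in S -> w \in A by rewrite inE => /andP[].
  have nSv : v \notin S by rewrite !inE eqxx /= andbF.
  have cardS : tau <= #|S| * K.
    apply: leq_trans deg_v _; apply: edeg_le_nbrs H_Delta2 (xedges_sub _ _) _.
    by move=> e Xe _; apply: xedges_two Xe nW.
  apply: (@G_forced _ _ S).
  - move=> w N' Sw; have := Sw; rewrite inE => /and3P[_ _ /existsP[e]].
    case/and3P=> Xe ve we; have := Xe; rewrite inE => /and3P[He /eqP eW _].
    apply: (G_edge _ He); have nwv : w != v by apply: contraNneq nSv => <-.
    have := S_A w Sw; rewrite inA => /and3P[nWw _ _].
    (* [e] consists of its vertex in [W] together with [v] and [w], so selecting [w] as well would
       complete it. *)
    have s3 : #|e :&: W :|: [set v; w]| = 3.
      rewrite cardsU eW cards2 eq_sym nwv /= (_ : _ :&: _ = set0) ?cards0 //.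
      apply/setP=> u; rewrite !inE; case: eqP => [->|_]; first by rewrite (negbTE nW) andbF.
      by case: eqP => [->|_]; rewrite ?(negbTE nWw) andbF.
    have /eqP <- : e :&: W :|: [set v; w] == e.
      rewrite eqEcard s3 (H3 He) leqnn andbT; apply/subsetP=> u; rewrite !inE.
      by case/orP=> [/andP[]//|/orP[]/eqP->].
    by apply/subsetP=> u; rewrite !inE => /orP[/andP[_ ->]|/orP[]->]; rewrite ?orbT.
  - rewrite disjoint_sym disjointsU //; first by rewrite disjoints1.
    rewrite disjoint_sym; apply/pred0P=> w /=; apply/negP=> /andP[/S_A/Y_v Yw].
    by rewrite (negbTE Yw).
  have -> : v |: (W :|: W1) = W :|: (v |: W1) by rewrite setUCA.
  have eqD : (v |: W1) :|: (S :|: N) = (v |: S) :|: D.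
    by rewrite -!setUA; congr (_ :|: _); rewrite setUCA.
  have disvSD : [disjoint v |: S & D].
    rewrite disjointsU ?disjoints1 ?inE ?negb_or ?nW1 //.
    apply/pred0P=> w /=; apply/negP=> /andP[/S_A].
    by rewrite inA => /and3P[_ /negbTE h1 /negbTE h2]; rewrite inE h1 h2.
  have card_vS : #|v |: S| = #|S|.+1 by rewrite cardsU1 nSv.
  apply: IH.
  - apply: leq_trans cardA; apply/proper_card/properP; split.
      by rewrite eqD setCS; apply: setUS; apply: subsetUr.
    by exists v => //; rewrite eqD !inE eqxx !orbT.
  - by rewrite disjoint_sym disjointsU // ?disjoints1 // disjoint_sym.
  - apply/pred0P=> w /=; apply/negP=> /andP[]; rewrite in_setU.
    move=> h /setUP[Sw|Nw].
      case/orP: h; first by move: (S_A w Sw); rewrite inA => /and3P[/negbTE->].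
      case/setU1P=> [eq_wv|]; first by rewrite eq_wv (negbTE nSv) in Sw.
      by move: (S_A w Sw); rewrite inA => /and3P[_ /negbTE->].
    have /negP[] : w \notin W :|: (v |: W1).
      rewrite setUCA inE negb_or (disjointFl disN Nw) andbT inE.
      by apply: contraNneq nN => <-.
    by rewrite inE.
  - rewrite eqD => u nu; apply: leq_trans (edeg_xedges_grow _ _ _ _) _.
    apply: degX; apply: contra nu; rewrite !in_setU => /orP[->//|->].
    by rewrite !orbT.
  - have grow u : u \in v |: S -> edeg (xedges W D) u <= tau + K.
      move=> /setU1P vSu; apply: degX.
      have : u \in A by case: vSu => [->|/S_A].
      by rewrite inE.
    have := xedges_grow grow; rewrite eqD card_vS cardsU.
    have -> : (v |: S) :&: D = set0 by apply/eqP; rewrite setI_eq0.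
    by rewrite cards0 card_vS subn0; move: potX; nia.
  - rewrite !cardsU1 nW1 (_ : #|S :|: N| = #|S| + #|N|) /=; first by rewrite !mulnDl mul1n leq_add.
    rewrite cardsU (_ : S :&: N = set0) ?cards0 ?subn0 //.
    apply/eqP; rewrite setI_eq0; apply/pred0P=> w /=; apply/negP=> /andP[/S_A/N_v].
    by move/negP.
rewrite negb_exists => /forallP small.
have {}small v : v \in A -> edeg (xedges W D) v < tau.
  by move=> Av; have := small v; rewrite Av /= -ltnNge.
pose HA : hgraph n := [set e in H | e \subset A].
(* Second case: those degrees are below [tau], but some [v] has degree at least [d] among the edges
   inside [A]. If selected it joins [W], which turns these edges into members of [xedges]. *)
have [/existsP[v /andP[Av deg_v]]|] := boolP [exists v in A, d <= edeg HA v].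
  have := Av; rewrite inA => /and3P[nW nW1 nN].
  apply: (G_split (Y_v v Av) (N_v v Av)); last exact: no_branch.
  rewrite setUA; apply: IH => //.
  - apply: leq_trans cardA; apply/proper_card/properP; split.
      by rewrite setCS -setUA; apply: subsetUr.
    by exists v => //; rewrite !inE eqxx.
  - by rewrite disjointsU // disjoints1.
  - by rewrite -setUA disjointsU // disjoints1.
  - move=> u; rewrite -/D -setUA in_setU1 negb_or => /andP[nuv nu].
    have uA : u \in A by rewrite inE.
    (* Moving [v] into [W] creates at [u] only edges through both [u] and [v], hence at most [K] of
       them. *)
    apply: (@leq_trans (edeg (xedges W D) u + #|[set e in H | (u \in e) && (v \in e)]|)).
      apply: leq_trans (leq_card_setU _ _); apply/subset_leq_card/subsetP=> e.
      rewrite !inE => /andP[/and3P[-> eW ->] ->] /=; rewrite !andbT.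
      have [ve|ve] := boolP (v \in e); first by rewrite orbT.
      suff <- : e :&: (v |: W) = e :&: W by rewrite eW.
      apply/setP=> x; rewrite !inE; case: eqP => [->|//].
      by rewrite (negbTE ve).
    apply: leq_add; first exact/ltnW/small.
    exact: codeg_le_Delta2.
  (* The edges of [HA] through [v] are gained; the only edges lost are the fewer than [tau] members
     of [xedges W D] through [v]. *)
  - have gain : #|xedges W D| + edeg HA v <= #|xedges (v |: W) D| + edeg (xedges W D) v.
      have -> : #|xedges W D| = #|[set e in xedges W D | v \notin e]| + edeg (xedges W D) v.
        rewrite addnC -(cardsID [set e : {set 'I_n} | v \in e] (xedges W D)); congr (_ + _).
          by apply: eq_card => e; rewrite !inE.
        by apply: eq_card => e; rewrite !inE andbC.
      rewrite addnAC leq_add2r -cardsUI.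
      rewrite (_ : [set e in xedges W D | v \notin e] :&: _ = set0) ?cards0 ?addn0; last first.
        by apply/setP=> e; rewrite !inE; case: (v \in e); rewrite ?andbF.
      apply/subset_leq_card/subsetP=> e; rewrite !inE => /orP[].
        case/andP=> /and3P[-> eW ->] ve; rewrite andbT /=.
        suff -> : e :&: (v |: W) = e :&: W by [].
        apply/setP=> x; rewrite !inE; case: eqP => [->|//].
        by rewrite (negbTE ve).
      case/andP=> /andP[-> eA] ve /=.
      have eWv : e :&: (v |: W) = [set v].
        apply/setP=> x; rewrite !inE; case: eqP => [->|_]; first by rewrite ve.
        apply/negP=> /andP[/(subsetP eA)]; rewrite inA => /and3P[/negP h _ _].
        exact: h.
      rewrite eWv cards1 eqxx; apply/pred0P=> x /=; apply/negP=> /andP[/(subsetP eA)].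
      by rewrite inA => /and3P[_ /negbTE h1 /negbTE h2]; rewrite inE h1 h2.
    have := small v Av; rewrite cardsU1 nW /= -/D.
    rewrite -(addnA 1) mulnDl mul1n (mulnDl 1 (#|W| + #|D|)) mul1n.
    move: potX gain deg_v; move: (#|W| * d) (edeg HA v) (edeg (xedges W D) v).
    move: #|xedges W D| #|xedges (v |: W) D| ((#|W| + #|D|) * (tau + K)) => *.
    by lia.
(* Otherwise all degrees inside [A] are below [d], so [A] spans at most [n * d] edges and the
   procedure stops. The degree bound caps [xedges W D], which makes the potential inequality a bound
   on [#|W|]. *)
rewrite negb_exists => /forallP smallA; apply: G_leaf => //.
- have X_le : #|xedges W D| <= #|A| * (tau + K).
    apply: (@leq_trans (\sum_(v in A) edeg (xedges W D) v)).
      apply: card_le_sum_edeg => e Xe; have := Xe; rewrite inE.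
      case/and3P=> He /eqP eW eD.
      have /card_gt0P[v] : 0 < #|e :\: W|.
        by have := cardsID W e; rewrite eW (H3 He); lia.
      rewrite !inE => /andP[nW ev]; exists v => //.
      by have := disjointFr eD ev; rewrite inA nW !inE; case: (v \in W1) => //= ->.
    rewrite -sum_nat_const; apply: leq_sum => v Av.
    by apply: leq_trans (ltnW (small v Av)) _; apply: leq_addr.
  have cardn : #|W| + #|D| + #|A| = n.
    rewrite -[RHS]card_ord -(cardsC (W :|: D)) cardsU.
    rewrite (_ : W :&: D = set0) ?cards0 ?subn0 //.
    apply/eqP; rewrite setI_eq0 disjoint_sym disjointsU // disjoint_sym //.
    by apply: disjointWl disN; apply: subsetUl.
  apply: leq_trans potX _.
  apply: (@leq_trans ((#|W| + #|D| + #|A|) * (tau + K))); last by rewrite cardn.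
  by rewrite [X in _ <= X]mulnDl addnC leq_add2l.
- apply: leq_trans potN _; rewrite leq_mul2r; apply/orP; right.
  by rewrite -[n in _ <= n]card_ord max_card.
rewrite -setUA -/D -/A; apply: (@leq_trans (\sum_(v in A) edeg HA v)).
  apply: card_le_sum_edeg => e; rewrite inE => /andP[He eA].
  have /card_gt0P[v ev] : 0 < #|e| by rewrite (H3 He).
  by exists v => //; apply: (subsetP eA).
apply: (@leq_trans (#|A| * d)).
  rewrite -sum_nat_const; apply: leq_sum => v Av.
  by have := smallA v; rewrite Av /= -ltnNge => /ltnW.
by rewrite leq_mul2r -{1}[n in _ <= n]card_ord max_card orbT.
Qed.

Lemma container : G set0 set0.
Proof.
rewrite -[X in G X _](setU0 set0).
apply: container_state; rewrite ?cards0 ?mul0n //; first by rewrite -setI_eq0 set0I.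
- by rewrite -setI_eq0 setI0.
move=> v _; rewrite (_ : edeg _ v = 0) //.
apply/eqP; rewrite cards_eq0; apply/eqP/setP=> e; rewrite !inE setI0 cards0 /=.
by rewrite andbF.
Qed.

End Container.

(** * Weighted counting *)

Lemma INR_leq a b : (a <= b)%N -> (INR a <= INR b)%R.
Proof. by move/leP; apply: le_INR. Qed.

Lemma INR_addn a b : INR (a + b)%N = (INR a + INR b)%R.
Proof. exact: plus_INR. Qed.

Lemma INR_muln a b : INR (a * b)%N = (INR a * INR b)%R.
Proof. exact: mult_INR. Qed.

Lemma INR_expn a k : INR (expn a k) = (INR a ^ k)%R.
Proof. by elim: k => [|k IH] //; rewrite expnS INR_muln IH. Qed.

(** [y / (1 + y)] is the probability of each vertex in a random set whose law is proportional to
    [y ^ #|I|]. *)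
Lemma tilt_prob_bounds (y : R) : (0 < y)%R -> (0 < y / (1 + y) < 1)%R.
Proof.
move=> y0; split; first by apply: Rdiv_lt_0_compat; lra.
apply: (Rmult_lt_reg_r (1 + y)); first lra.
by rewrite /Rdiv Rmult_assoc Rinv_l; lra.
Qed.

Definition cnt n (F : {set {set 'I_n}}) (Y N : {set 'I_n}) : nat :=
  #|[set I in F | (Y \subset I) && [disjoint I & N]]|.

Lemma cnt_split n (F : {set {set 'I_n}}) (Y N : {set 'I_n}) v :
  cnt F Y N = (cnt F (v |: Y) N + cnt F Y (v |: N))%N.
Proof.
rewrite /cnt -(cardsID [set I : {set 'I_n} | v \in I] [set I in F | _]).
congr (_ + _); apply: eq_card => I; rewrite !inE.
  by rewrite subUset sub1set; case: (v \in I); rewrite /= ?andbF ?andbT.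
rewrite -!setI_eq0 setIUr setU_eq0 !setI_eq0 [in RHS]disjoint_sym disjoints1.
by case: (v \in I); rewrite /= ?andbF.
Qed.

Lemma cnt_setT n (F : {set {set 'I_n}}) : cnt F set0 set0 = #|F|.
Proof.
apply: eq_card => I; rewrite !inE sub0set -setI_eq0 setI0 eqxx.
by rewrite !andbT.
Qed.

Lemma free_U1l n (Y N : {set 'I_n}) v :
  ~: (v |: Y :|: N) = ~: (Y :|: N) :\ v.
Proof. by apply/setP=> u; rewrite !inE -orbA negb_or. Qed.

Lemma free_U1r n (Y N : {set 'I_n}) v :
  ~: (Y :|: (v |: N)) = ~: (Y :|: N) :\ v.
Proof. by rewrite setUCA -free_U1l setUA. Qed.

Lemma disjoint_U1 n (Y N : {set 'I_n}) v :
  v \in ~: (Y :|: N) -> [disjoint Y & N] ->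
  [disjoint v |: Y & N] /\ [disjoint Y & v |: N].
Proof.
rewrite !inE negb_or => /andP[nY nN] disYN; split.
  by apply: disjointsU; rewrite ?disjoints1.
by rewrite disjoint_sym; apply: disjointsU; rewrite ?disjoints1 // disjoint_sym.
Qed.

(* Weigh a set [I] by [y ^ #|I| * w ^ #|I :\: X|] and expose it one vertex at
   a time. *)
Lemma cnt_weight n (F : {set {set 'I_n}}) (X : {set 'I_n}) (y w M : R) :
  (0 < y)%R -> (0 < w)%R ->
  (forall I, I \in F -> M <= y ^ #|I| * w ^ #|I :\: X|)%R ->
  forall Y N : {set 'I_n}, [disjoint Y & N] ->
  (INR (cnt F Y N) * M <= y ^ #|Y| * w ^ #|Y :\: X| *
     ((1 + y) ^ #|~: (Y :|: N) :&: X| * (1 + y * w) ^ #|~: (Y :|: N) :\: X|))%R.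
Proof.
move=> y0 w0 leM Y N; have [k] := ubnP #|~: (Y :|: N)|.
elim: k => // k IH in Y N *; rewrite ltnS => cardA disYN.
set A := ~: (Y :|: N) in cardA *.
have yw0 : (0 < y * w)%R by apply: Rmult_lt_0_compat.
have [A0|[v Av]] := set_0Vmem A.
  rewrite A0 set0I set0D cards0 !pow_O !Rmult_1_r.
  have pos : (0 < y ^ #|Y| * w ^ #|Y :\: X|)%R.
    by apply: Rmult_lt_0_compat; apply: pow_lt.
  have sub1 : [set I in F | (Y \subset I) && [disjoint I & N]] \subset [set Y].
    apply/subsetP=> I; rewrite !inE => /and3P[_ YI disIN]; rewrite eqEsubset YI andbT.
    apply/subsetP=> u Iu; move/setP/(_ u): A0; rewrite !inE (disjointFr disIN Iu) orbF.
    by move/negbFE.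
  have [Y_F|Y_F] := boolP (Y \in F).
    have : (cnt F Y N <= 1)%N by rewrite -(cards1 Y); apply: subset_leq_card.
    by have := leM Y Y_F; case: (cnt F Y N) => [|[|j]] h // _; rewrite ?INR_0 ?INR_1; lra.
  rewrite (_ : cnt F Y N = 0) ?INR_0; first lra.
  apply/eqP; rewrite cards_eq0; apply/eqP/setP=> I; rewrite [RHS]inE; apply/negP=> h.
  have /(subsetP sub1) := h; rewrite inE => /eqP E; move: h.
  by rewrite E inE (negbTE Y_F).
have [disv1 disv2] := disjoint_U1 Av disYN.
have /andP[nY _] : (v \notin Y) && (v \notin N) by move: Av; rewrite !inE negb_or.
have cardA' : (#|A :\ v| < k)%N by move: cardA; rewrite (cardsD1 v A) Av.
have := IH (v |: Y) N; rewrite free_U1l -/A => /(_ cardA' disv1) IH1.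
have := IH Y (v |: N); rewrite free_U1r -/A => /(_ cardA' disv2) IH2.
rewrite (cnt_split _ _ _ v) INR_addn Rmult_plus_distr_r.
apply: Rle_trans (Rplus_le_compat _ _ _ _ IH1 IH2) _; right.
rewrite cardsU1 nY add1n -tech_pow_Rmult.
(* Deciding [v] contributes the factor [1 + y] if it lies in [X], and [1 + y * w] otherwise. *)
have [Xv|Xv] := boolP (v \in X).
  rewrite (_ : #|(v |: Y) :\: X| = #|Y :\: X|); last first.
    by apply: eq_card => u; rewrite !inE; case: eqP => // ->; rewrite Xv.
  rewrite (_ : #|A :\ v :\: X| = #|A :\: X|); last first.
    by apply: eq_card => u; rewrite !inE; case: eqP => // ->; rewrite Xv.
  rewrite (cardsD1 v (A :&: X)) !inE Xv andbT.
  have -> : ~~ ((v \in Y) || (v \in N)) by move: Av; rewrite !inE.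
  rewrite (_ : #|(A :&: X) :\ v| = #|(A :\ v) :&: X|) ?add1n -?tech_pow_Rmult; first ring.
  by apply: eq_card => u; rewrite !inE andbA.
rewrite (_ : (v |: Y) :\: X = v |: Y :\: X); last first.
  by apply/setP=> u; rewrite !inE; case: eqP => // ->; rewrite Xv.
rewrite cardsU1 !inE negb_and nY orbT add1n -tech_pow_Rmult.
rewrite (_ : #|(A :\ v) :&: X| = #|A :&: X|); last first.
  apply: eq_card => u; rewrite !inE; case: eqP => // ->.
  by rewrite (negbTE Xv) !andbF.
rewrite (cardsD1 v (A :\: X)) !inE Xv.
have -> : ~~ ((v \in Y) || (v \in N)) by move: Av; rewrite !inE.
rewrite (_ : #|(A :\: X) :\ v| = #|A :\ v :\: X|) ?add1n -?tech_pow_Rmult; first ring.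
by apply: eq_card => u; rewrite !inE andbCA.
Qed.

(** * The largest term of a binomial expansion *)

Section BinomialMode.

Local Notation "x ^ k" := (expn x k) : nat_scope.

(** The terms [f i] add up to [b.+1 ^ b] by the binomial theorem. Ratios of consecutive terms show
    that they increase up to [i = m] and decrease afterwards, so each of the [b.+1] terms is at most
    [f m]. *)
Lemma bin_tilt_nat b m : m <= b ->
  b.+1 ^ b <= b.+1 * ('C(b, m) * ((b - m).+1 ^ (b - m) * m ^ m)).
Proof.
move=> le_mb; pose f i := 'C(b, i) * ((b - m).+1 ^ (b - i) * m ^ i).
have key i : i < b -> f i = 'C(b, i) * ((b - m).+1 * ((b - m).+1 ^ (b - i.+1) * m ^ i))
    /\ f i.+1 = 'C(b, i.+1) * (m * ((b - m).+1 ^ (b - i.+1) * m ^ i)).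
  move=> lt_ib; rewrite /f; split; last by congr (_ * _); rewrite expnS mulnCA.
  by rewrite (_ : b - i = (b - i.+1).+1) ?expnS ?mulnA //; lia.
have up i : i < m -> f i <= f i.+1.
  move=> lt_im; have [|-> ->] := key i; first by lia.
  rewrite -(leq_pmul2l (ltn0Sn i)) [X in _ <= X]mulnA mul_bin_left !mulnA.
  rewrite !leq_mul2r; apply/orP; right; apply/orP; right.
  rewrite mulnAC [X in _ <= X]mulnAC leq_mul2r; apply/orP; right.
  by rewrite [X in _ <= X]mulnC; apply: leq_mul; lia.
have down i : m <= i -> i < b -> f i.+1 <= f i.
  move=> le_mi lt_ib; have [//|-> ->] := key i.
  rewrite -(leq_pmul2l (ltn0Sn i)) mulnA mul_bin_left !mulnA.
  rewrite !leq_mul2r; apply/orP; right; apply/orP; right.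
  rewrite mulnAC [X in _ <= X]mulnAC leq_mul2r; apply/orP; right.
  by rewrite mulnC; apply: leq_mul; lia.
have max_f i : i <= b -> f i <= f m.
  move=> le_ib; have [le_im|lt_mi] := leqP i m.
    rewrite -(subKn le_im); move: (m - i) (leq_subr i m) => j.
    elim: j => [|j IHj] le_jm; first by rewrite subn0.
    apply: leq_trans (IHj _); last by lia.
    have -> : m - j = (m - j.+1).+1 by lia.
    by apply: up; lia.
  have {lt_mi} [j Ej] : exists j, i = m + j by exists (i - m); lia.
  rewrite {i}Ej in le_ib *.
  elim: j le_ib => [|j IHj] le_jb; first by rewrite addn0.
  apply: leq_trans (IHj _); last by lia.
  by rewrite addnS; apply: down; lia.
rewrite [X in X ^ b <= _](_ : _ = (b - m).+1 + m); last by lia.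
rewrite expnDn -[b.+1 in X in _ <= X](card_ord b.+1) -sum_nat_const.
by apply: leq_sum => i _; apply: max_f; rewrite -ltnS.
Qed.

End BinomialMode.

(* This [y] puts the mode of the terms ['C(b, i) * y ^ i] at [i = m]. *)
Lemma bin_tilt b m : m <= b -> let y := (INR m / INR (b - m).+1)%R in
  ((1 + y) ^ b <= INR b.+1 * (INR 'C(b, m) * y ^ m))%R.
Proof.
move=> le_mb y; have w0 : (0 < INR (b - m).+1)%R by apply: lt_0_INR; lia.
have Ey : (1 + y = INR b.+1 / INR (b - m).+1)%R.
  rewrite /y; have -> : (INR b.+1 = INR (b - m).+1 + INR m)%R.
    by rewrite -INR_addn; congr INR; lia.
  by field; lra.
have h := INR_leq (bin_tilt_nat le_mb).
rewrite !INR_muln !INR_expn in h.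
rewrite Ey /y !Rpow_mult_distr !pow_inv.
have Eb : ((INR (b - m).+1) ^ b = (INR (b - m).+1) ^ (b - m) * (INR (b - m).+1) ^ m)%R.
  by rewrite -Rdef_pow_add; congr (_ ^ _)%R; rewrite plusE; lia.
have p1 : (0 < INR (b - m).+1 ^ b)%R by apply: pow_lt.
have p2 : (0 < INR (b - m).+1 ^ m)%R by apply: pow_lt.
apply: (Rmult_le_reg_r (INR (b - m).+1 ^ b)) => //.
rewrite Rmult_assoc Rinv_l ?Rmult_1_r; last lra.
apply: Rle_trans h _; right; rewrite Eb; field; lra.
Qed.

(** * The gain from exposing vertices with many conflicts *)

Lemma bernoulli_inv (q : R) (j : nat) :
  (0 <= q <= 1)%R -> ((1 - q) ^ j * (1 + INR j * q) <= 1)%R.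
Proof.
move=> q01; elim: j => [|j IH]; first by rewrite /=; lra.
have pj : (0 <= (1 - q) ^ j)%R by apply: pow_le; lra.
have j0 := pos_INR j.
rewrite S_INR /=; apply: Rle_trans IH; rewrite -[X in (_ <= X)%R]Rmult_1_l.
rewrite Rmult_assoc [((1 - q) * _)%R]Rmult_comm.
rewrite Rmult_1_l Rmult_assoc; apply: Rmult_le_compat_l => //.
by nra.
Qed.

(* With [x = kappa * p], the rate [1 - p * th] for [th = x / (4 * (1 + x))] makes
   the recursion [(1 - p) + p * ((1 - p) / rho) ^ kappa <= rho] of [cnt_sparse]
   hold. *)
Definition decay (p kappa : R) : R :=
  (1 - p * (kappa * p / (4 * (1 + kappa * p))))%R.

Lemma decay_arg_bounds (x : R) : (0 <= x)%R -> (0 <= x / (4 * (1 + x)) <= 1 / 4)%R.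
Proof.
move=> x0; split; first by apply: Rle_mult_inv_pos; lra.
apply: (Rmult_le_reg_r (4 * (1 + x))); first lra.
by rewrite /Rdiv Rmult_assoc Rinv_l; lra.
Qed.

Lemma decay_bounds (p kappa : R) :
  (0 < p < 1)%R -> (0 <= kappa)%R -> (0 < decay p kappa <= 1)%R.
Proof.
move=> p01 kap0; have x0 : (0 <= kappa * p)%R by apply: Rmult_le_pos; lra.
have := decay_arg_bounds x0; rewrite /decay; move: (_ / _)%R => th ?.
by split; nra.
Qed.

(** As [(1 - p) / (1 - p * th) <= 1 - p * (1 - th)] and [th <= 1 / 4], [bernoulli_inv] bounds the
    power by [1 / (1 + 3 / 4 * x)]. This is at most [1 - th], so the left side is at most
    [1 - p * th]. *)
Lemma decay_step (p kappa : R) (j : nat) :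
  (0 < p < 1)%R -> (0 <= kappa <= INR j)%R ->
  ((1 - p) + p * ((1 - p) / decay p kappa) ^ j <= decay p kappa)%R.
Proof.
move=> p01 kj; rewrite /decay; set x := (kappa * p)%R.
have xj : (x <= INR j * p)%R by apply: Rmult_le_compat_r; lra.
have x0 : (0 <= x)%R by apply: Rmult_le_pos; lra.
set th := (x / (4 * (1 + x)))%R.
have Eth : (th * (4 * (1 + x)) = x)%R by rewrite /th; field; lra.
have [th0 th1] : (0 <= th <= 1 / 4)%R by apply: decay_arg_bounds.
clearbody th x => {kj}.
have rho0 : (0 < 1 - p * th)%R by nra.
have z_le : ((1 - p) / (1 - p * th) <= 1 - p * (1 - th))%R.
  apply: (Rmult_le_reg_r (1 - p * th)) => //.
  rewrite /Rdiv Rmult_assoc Rinv_l ?Rmult_1_r; last lra.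
  have : (0 <= p * p * th * (1 - th))%R by repeat apply: Rmult_le_pos; lra.
  by nra.
have z0 : (0 <= (1 - p) / (1 - p * th))%R by apply: Rle_mult_inv_pos; lra.
have q01 : (0 <= p * (1 - th) <= 1)%R by nra.
have pw := pow_incr _ _ j (conj z0 z_le).
have bern := bernoulli_inv j q01.
set z := ((1 - p * (1 - th)) ^ j)%R in pw bern.
have zz : (0 <= z)%R by apply: pow_le; lra.
have jq : (3 / 4 * x <= INR j * (p * (1 - th)))%R.
  by nra.
have zle : (z * (1 + 3 / 4 * x) <= 1)%R.
  by apply: Rle_trans bern; apply: Rmult_le_compat_l => //; lra.
have z_th : (z <= 1 - th)%R.
  apply: (Rmult_le_reg_r (1 + 3 / 4 * x)); first by lra.
  apply: Rle_trans zle _.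
  apply: (Rmult_le_reg_r (4 * (1 + x))); first by lra.
  have -> : ((1 - th) * (1 + 3 / 4 * x) * (4 * (1 + x)) =
    (4 * (1 + x) - th * (4 * (1 + x))) * (1 + 3 / 4 * x))%R by ring.
  by rewrite Eth; nra.
apply: (@Rle_trans _ (1 - p + p * z)%R); first by nra.
by nra.
Qed.

(* If, however the vertices outside a large part [A] of [X] were decided, some
   [v] in [A] conflicts with many vertices of [A], then exposing [v] gains a
   constant factor; up to [T] exposures are possible. *)
Lemma cnt_sparse n (F : {set {set 'I_n}}) (X : {set 'I_n}) (T m : nat) (y kappa : R) :
  (0 < y)%R -> (0 <= kappa)%R -> (forall I, I \in F -> #|I| = m) ->
  (forall A : {set 'I_n}, A \subset X -> #|X :\: A| <= T ->
     exists v (W : {set 'I_n}), [/\ v \in A, W \subset A :\ v, (kappa <= INR #|W|)%R &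
       forall I, I \in F -> v \in I -> [disjoint I & W]]) ->
  forall t (Y N : {set 'I_n}), [disjoint Y & N] -> ~: (Y :|: N) \subset X ->
  t = 0 \/ #|X :\: ~: (Y :|: N)| + t <= T ->
  (INR (cnt F Y N) * y ^ m <=
     y ^ #|Y| * (1 + y) ^ #|~: (Y :|: N)| * decay (y / (1 + y)) kappa ^ t)%R.
Proof.
move=> y0 kap0 cardF conflict t Y N.
have [k] := ubnP #|~: (Y :|: N)|.
elim: k => // k IH in t Y N *; rewrite ltnS => cardA disYN subX tT.
set A := ~: (Y :|: N) in cardA subX tT *.
set p := (y / (1 + y))%R in IH *; set rho := decay p kappa in IH *.
have p01 : (0 < p < 1)%R by apply: tilt_prob_bounds.
(* With no exposure left, the plain bound of [cnt_weight] at [w = 1] is enough. *)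
case: t tT => [|t] tT.
  rewrite pow_O Rmult_1_r.
  have leM I : I \in F -> (y ^ m <= y ^ #|I| * 1 ^ #|I :\: X|)%R.
    by move/cardF->; rewrite pow1; lra.
  apply: Rle_trans (cnt_weight y0 Rlt_0_1 leM disYN) _; right.
  by rewrite !pow1 !Rmult_1_r -/A -(cardsID X A) -plusE Rdef_pow_add.
case: tT => [//|tT].
have [|v [W [Av subW kapW disW]]] := conflict A subX.
  by apply: leq_trans tT; apply: leq_addr.
have [disv1 disv2] := disjoint_U1 Av disYN.
have /andP[nY nN] : (v \notin Y) && (v \notin N) by move: Av; rewrite !inE negb_or.
have WA w : w \in W -> w \in A by move/(subsetP subW)/setD1P=> [].
have disvW : [disjoint v |: Y & W].
  apply: disjointsU; first by rewrite disjoints1; apply/negP=> /(subsetP subW); rewrite !inE eqxx.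
  by apply/pred0P=> w /=; apply/negP=> /andP[Yw /WA]; rewrite !inE Yw.
(* A member that contains [v] avoids [W], so [W] is rejected along with the selection of [v]. *)
have cntW : cnt F (v |: Y) N = cnt F (v |: Y) (W :|: N).
  apply: eq_card => I; rewrite !inE subUset sub1set.
  case: (boolP (I \in F)) => //= IF; case: (boolP (v \in I)) => //= Iv.
  by rewrite -!setI_eq0 setIUr setU_eq0 (setI_eq0 I W) (disW _ IF Iv).
have freeW : ~: (v |: Y :|: (W :|: N)) = (A :\ v) :\: W.
  by apply/setP=> u; rewrite !inE; case: (u == v) => //=; case: (u \in Y); case: (u \in W).
have cardAv : #|A| = (#|A :\ v|).+1 by rewrite (cardsD1 v A) Av.
have cardAvW : #|A :\ v| = #|W| + #|(A :\ v) :\: W|.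
  by rewrite -(cardsID W (A :\ v)) (setIidPr subW).
have cardX' (B' : {set 'I_n}) : B' \subset A -> #|X :\: B'| = #|X :\: A| + #|A :\: B'|.
  move=> sB; rewrite -(cardsID A (X :\: B')) addnC; congr (_ + _).
    apply: eq_card => u; rewrite !inE; have [uB|//] := boolP (u \in B').
    by move/(subsetP sB): uB; rewrite !inE => ->.
  apply: eq_card => u; rewrite !inE; have [//|_] := boolP (u \in B').
  rewrite andbC /=; have [uA|//] := boolP (u \in A).
    by move/(subsetP subX): (uA) => ->; move: uA; rewrite !inE => ->.
  by rewrite !inE => /negbTE->; rewrite ?andbF.
(* Selecting [v] takes [v] and [W] out of the free part and so uses [#|W|] further units of the
   budget [T]. If [t < #|W|], the truncated difference is [0] and the alternative [t = 0]
   applies. *)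
have IH1 : (INR (cnt F (v |: Y) N) * y ^ m <=
    y ^ #|Y|.+1 * (1 + y) ^ #|(A :\ v) :\: W| * rho ^ (t - #|W|))%R.
  have := IH (t - #|W|)%N (v |: Y) (W :|: N).
  rewrite freeW cntW cardsU1 nY; apply.
  - by move: cardA; rewrite cardAv cardAvW; lia.
  - rewrite disjoint_sym; apply: disjointsU; rewrite disjoint_sym //.
  - apply: subset_trans (subsetDl _ _) _; apply: subset_trans (subsetDl _ _) _.
    exact: subX.
  - have [le_Wt|lt_tW] := leqP #|W| t; last by left; lia.
    right; rewrite cardX'; last by apply: subset_trans (subsetDl _ _) (subsetDl _ _).
    have : #|A :\: (A :\ v :\: W)| = #|W|.+1.
      have := cardsID (A :\ v :\: W) A.
      rewrite (setIidPr _); last by apply: subset_trans (subsetDl _ _) (subsetDl _ _).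
      by rewrite cardAv cardAvW; lia.
    by move: tT; lia.
have IH2 : (INR (cnt F Y (v |: N)) * y ^ m <=
    y ^ #|Y| * (1 + y) ^ #|A :\ v| * rho ^ t)%R.
  have := IH t Y (v |: N); rewrite free_U1r -/A; apply=> //.
  - by move: cardA; rewrite cardAv; lia.
  - by apply: subset_trans (subsetDl _ _) subX.
  - right; rewrite cardX' ?subsetDl //.
    have := cardsID (A :\ v) A; rewrite (setIidPr (subsetDl _ _)) cardAv.
    by move: tT; lia.
have kj : (0 <= kappa <= INR #|W|)%R by [].
have rho01 : (0 < rho <= 1)%R by apply: decay_bounds.
have := decay_step p01 kj; rewrite -/p -/rho => step.
rewrite (cnt_split _ _ _ v) INR_addn Rmult_plus_distr_r cardAv.
apply: Rle_trans (Rplus_le_compat _ _ _ _ IH1 IH2) _.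
set j := #|W| in cardAvW step *; set P := ((1 + y) ^ _)%R; set a := ((1 + y) ^ #|A :\ v|)%R.
have E1p : (1 - p = / (1 + y))%R by rewrite /p; field; lra.
have EP : (P = a * (1 - p) ^ j)%R.
  rewrite /P /a cardAvW -plusE Rdef_pow_add E1p pow_inv; field.
  by apply: pow_nonzero; lra.
have Er : (rho ^ (t - j) <= rho ^ t * (/ rho) ^ j)%R.
  have rj : (0 < rho ^ j)%R by apply: pow_lt; lra.
  apply: (Rmult_le_reg_r (rho ^ j)) => //.
  rewrite pow_inv Rmult_assoc Rinv_l ?Rmult_1_r; last by lra.
  rewrite -Rdef_pow_add; have [le_jt|lt_tj] := leqP j t.
    by rewrite plusE subnK //; lra.
  rewrite (_ : (t - j + j)%coq_nat = t + (j - t)); last by lia.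
  rewrite -plusE Rdef_pow_add; have rt : (0 < rho ^ t)%R by apply: pow_lt; lra.
  have : (rho ^ (j - t) <= 1)%R by rewrite -(pow1 (j - t)); apply: pow_incr; lra.
  by nra.
have yY : (0 < y ^ #|Y|)%R by apply: pow_lt.
have a0 : (0 < a)%R by apply: pow_lt; lra.
have rt : (0 < rho ^ t)%R by apply: pow_lt; lra.
have Ey : (y = p * (1 + y))%R by rewrite /p; field; lra.
have P0 : (0 < P)%R by apply: pow_lt; lra.
apply: (@Rle_trans _ (y * y ^ #|Y| * P * (rho ^ t * (/ rho) ^ j) + y ^ #|Y| * a * rho ^ t)%R).
  apply: Rplus_le_compat_r; rewrite [(y ^ _.+1)%R]/=; apply: Rmult_le_compat_l => //.
  by apply: Rlt_le; repeat apply: Rmult_lt_0_compat => //; lra.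
rewrite EP; have -> : (y * y ^ #|Y| * (a * (1 - p) ^ j) * (rho ^ t * (/ rho) ^ j) +
    y ^ #|Y| * a * rho ^ t = y ^ #|Y| * a * rho ^ t *
    (y * ((1 - p) / rho) ^ j + 1))%R.
  by rewrite /Rdiv Rpow_mult_distr; ring.
have -> : (y ^ #|Y| * (1 + y) ^ #|A :\ v|.+1 * rho ^ t.+1 =
    y ^ #|Y| * a * rho ^ t * ((1 + y) * rho))%R by rewrite /= -/a; ring.
apply: Rmult_le_compat_l; first by apply: Rlt_le; repeat apply: Rmult_lt_0_compat.
have -> : (y * ((1 - p) / rho) ^ j + 1 =
   (1 + y) * ((1 - p) + p * ((1 - p) / rho) ^ j))%R.
  rewrite {1}Ey E1p; move: (((_ / _) ^ _)%R) => z; field; lra.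
by apply: Rmult_le_compat_l; lra.
Qed.

(** * Sets close to a member of the family *)

Lemma independent_sub n (H : hgraph n) (A I : {set 'I_n}) :
  independent H A -> I \subset A -> independent H I.
Proof.
move=> /forall_inP indA sIA; apply/forall_inP=> e He.
by apply: contra (indA e He) => sEI; apply: subset_trans sIA.
Qed.

(** All [m]-subsets of a maximum independent set are independent; this bounds the denominator of the
    proportion from below. *)
Lemma bin_le_indep_sets n (H : hgraph n) b m :
  uniform3 H -> b <= indep_number H -> 'C(b, m) <= #|indep_sets H m|.
Proof.
move=> H3 le_b.
have ind0 : independent H set0.
  apply/forall_inP=> e He; rewrite subset0 -cards_eq0.
  by rewrite (H3 _ He).
have [|A indA EA] := @eq_bigmax_cond _ (independent H) (fun A : {set 'I_n} => #|A|).
  by apply/card_gt0P; exists set0.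
apply: (@leq_trans 'C(#|A|, m)); first by apply: leq_bin2l; rewrite -EA.
rewrite -cards_draws; apply/subset_leq_card/subsetP=> I; rewrite !inE.
by case/andP=> sIA ->; rewrite (independent_sub indA sIA).
Qed.

Lemma sum_edeg n (E : hgraph n) (U : {set 'I_n}) :
  \sum_(u in U) edeg E u = \sum_(e in E) #|e :&: U|.
Proof.
transitivity (\sum_(u in U) \sum_(e in E | u \in e) 1).
  apply: eq_bigr => u _; rewrite /edeg -sum1_card; apply: eq_bigl => e.
  by rewrite inE.
rewrite (exchange_big_dep (mem E)) /=; last by move=> u e _ /andP[].
apply: eq_bigr => e Ee; rewrite -sum1_card; apply: eq_bigl => u.
by rewrite inE Ee andbC.
Qed.

Definition sets_over n (H : hgraph n) m (X U : {set 'I_n}) : {set {set 'I_n}} :=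
  [set I in indep_sets H m | I :\: X == U].

Section NearSets.

Variables (n : nat) (H : hgraph n) (K T m : nat) (X U : {set 'I_n}) (c : R).
Hypothesis H3 : uniform3 H.
Hypothesis H_Delta2 : Delta2 H <= K.
Hypothesis disUX : [disjoint U & X].
Hypothesis degU : forall u, u \in U -> (c * INR n <= INR (deg_into H X u))%R.

(** As [U] is disjoint from [X], such an edge is a vertex of [U] plus a pair in [X], a pair that no
    independent set over [U] may contain. *)
Definition cross_edges : hgraph n :=
  [set e in H | (#|e :&: X| == 2) && (#|e :&: U| == 1)].

Lemma cross_edgesU e : e \in cross_edges -> e = (e :&: X) :|: (e :&: U).
Proof.
rewrite inE => /and3P[He /eqP eX /eqP eU]; apply/esym/eqP.
rewrite eqEcard -setIUr subsetIl (H3 He) setIUr cardsU eX eU.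
rewrite (_ : _ :&: (e :&: U) = set0) ?cards0 //.
apply/eqP; rewrite -subset0; apply/subsetP=> u; rewrite !inE => /andP[/andP[_ uX] /andP[_ uU]].
by rewrite (disjointFr disUX uU) in uX.
Qed.

(** An edge counted by [deg_into H X u] has [u] as its only vertex outside [X]; hence it is a cross
    edge and is counted for no other vertex of [U]. *)
Lemma card_cross_edges : (c * INR n * INR #|U| <= INR #|cross_edges|)%R.
Proof.
have -> : #|cross_edges| = \sum_(u in U) edeg cross_edges u.
  rewrite sum_edeg -sum1_card; apply: eq_bigr => e.
  by rewrite inE => /and3P[_ _ /eqP->].
have deg u : u \in U -> (c * INR n <= INR (edeg cross_edges u))%R.
  move=> Uu; apply: Rle_trans (degU Uu) _; apply: INR_leq.
  apply/subset_leq_card/subsetP=> e; rewrite !inE => /and3P[He /eqP eX eu].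
  rewrite He eX eu eqxx andbT !andTb; apply/eqP.
  have sub : e :&: U \subset e :\: X.
    apply/subsetP=> w; rewrite !inE => /andP[-> wU].
    by rewrite (disjointFr disUX wU).
  have := subset_leq_card sub; have := cardsID X e; rewrite eX (H3 He).
  have : 0 < #|e :&: U| by apply/card_gt0P; exists u; rewrite inE eu.
  by lia.
have -> : (c * INR n * INR #|U| = INR (\sum_(u in U) 1) * (c * INR n))%R.
  by rewrite sum1_card; ring.
elim/big_rec2: _ => [|u s1 s2 Uu IH]; first by rewrite INR_0; lra.
by rewrite !INR_addn INR_1; have := deg u Uu; lra.
Qed.

(** A vertex of [X] lies in at most [#|U| * K] cross edges, so losing [T] vertices leaves at least
    half of the guaranteed [c * n * #|U|]. By averaging, some [v] in [A] lies in [c * #|U| / 2] of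
    these, and [W] consists of its neighbours. *)
Lemma sets_over_conflict (A : {set 'I_n}) :
  (0 < c)%R -> 0 < n -> 0 < K -> 0 < #|U| -> (INR T * INR K <= c * INR n / 2)%R ->
  A \subset X -> #|X :\: A| <= T ->
  exists v (W : {set 'I_n}), [/\ v \in A, W \subset A :\ v,
      (c * INR #|U| / (2 * INR K) <= INR #|W|)%R &
      forall I, I \in sets_over H m X U -> v \in I -> [disjoint I & W]].
Proof.
move=> c0 n0 K0 U0 leT sAX leXA.
have n0R : (0 < INR n)%R by apply: lt_0_INR; lia.
have K0R : (0 < INR K)%R by apply: lt_0_INR; lia.
have U0R : (0 < INR #|U|)%R by apply: lt_0_INR; lia.
pose EA : hgraph n := [set e in cross_edges | [disjoint e & X :\: A]].
have sEAH : EA \subset H by apply/subsetP=> e; rewrite !inE => /andP[/and3P[]].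
have sEH : cross_edges \subset H by apply/subsetP=> e; rewrite !inE => /and3P[].
have EA_X e x : e \in EA -> x \in e -> x \in X -> x \in A.
  rewrite inE => /andP[_ dis] ex Xx; have := disjointFr dis ex.
  by rewrite inE Xx andbT => /negbFE.
have EA_cross e : e \in EA -> e \in cross_edges by rewrite inE => /andP[].
have degX x : x \in X :\: A -> edeg cross_edges x <= #|U| * K.
  rewrite inE => /andP[_ Xx].
  apply: leq_trans (edeg_le_nbrs (A := U) H_Delta2 sEH _) _.
    move=> e; rewrite inE => /and3P[_ _ /eqP eU] _.
    have /card_gt0P[u] : 0 < #|e :&: U| by rewrite eU.
    rewrite inE => /andP[eu Uu]; exists u => //; rewrite !inE Uu andbT.
    by apply: contraTneq Uu => ->; rewrite (disjointFl disUX Xx).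
  rewrite leq_mul2r; apply/orP; right; apply/subset_leq_card/subsetP=> u.
  by rewrite inE => /andP[].
have card_EA : #|cross_edges| <= #|EA| + T * (#|U| * K).
  apply: (@leq_trans (#|EA| + \sum_(x in X :\: A) edeg cross_edges x)).
    apply: leq_trans (leq_add (leqnn _) (card_bigcup_le _ _)).
    apply: leq_trans (leq_card_setU _ _).
    apply/subset_leq_card/subsetP=> e Ee; rewrite in_setU [e \in EA]inE Ee /=.
    have [//|] := boolP [disjoint e & X :\: A].
    case/pred0Pn=> x /andP[/= ex XAx].
    by apply/bigcupP; exists x => //; rewrite inE Ee.
  rewrite leq_add2l; apply: (@leq_trans (#|X :\: A| * (#|U| * K))).
    by rewrite -sum_nat_const; apply: leq_sum.
  by rewrite leq_mul2r leXA orbT.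
have EA_big : (c * INR n * INR #|U| / 2 <= INR #|EA|)%R.
  have := INR_leq card_EA; rewrite INR_addn !INR_muln.
  have := card_cross_edges.
  have : (INR T * (INR #|U| * INR K) <= c * INR n * INR #|U| / 2)%R.
    apply: (@Rle_trans _ (INR T * INR K * INR #|U|)%R); first by right; ring.
    apply: (@Rle_trans _ (c * INR n / 2 * INR #|U|)%R); last by right; field.
    by apply: Rmult_le_compat_r; lra.
  by lra.
have [v Av deg_v] : exists2 v, v \in A & #|EA| <= n * edeg EA v.
  apply/exists_inP; apply: contraT; rewrite negb_exists => /forallP small.
  have le1 : #|EA| <= \sum_(v in A) edeg EA v.
    apply: card_le_sum_edeg => e Ee; have := EA_cross e Ee.
    rewrite inE => /and3P[_ /eqP eX _].
    have /card_gt0P[x] : 0 < #|e :&: X| by rewrite eX.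
    by rewrite inE => /andP[ex Xx]; exists x; rewrite // (EA_X e).
  have EA0 : 0 < #|EA|.
    rewrite lt0n; apply/negP=> /eqP E0; move: EA_big; rewrite E0 INR_0.
    have : (0 < c * INR n * INR #|U|)%R by repeat apply: Rmult_lt_0_compat.
    by lra.
  have le2 : n * \sum_(v in A) edeg EA v <= #|A| * (#|EA|.-1).
    rewrite big_distrr /= -sum_nat_const; apply: leq_sum => v Av.
    have := small v; rewrite Av /= -ltnNge; lia.
  have le3 : #|A| <= n by rewrite -[n in _ <= n]card_ord max_card.
  by move: le1 le2 EA0 le3; move: #|EA| #|A| (\sum_(_ in _) _) => *; nia.
exists v, (nbrs EA A v); split=> //.
- by apply/subsetP=> w; rewrite !inE => /and3P[-> -> _].
- have leW : #|EA| <= n * (#|nbrs EA A v| * K).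
    apply: leq_trans deg_v _; rewrite leq_mul2l; apply/orP; right.
    apply: edeg_le_nbrs H_Delta2 sEAH _ => e Ee ve.
    have := EA_cross e Ee; rewrite inE => /and3P[_ /eqP eX _].
    have /card_gt0P[w] : 0 < #|(e :&: X) :\ v|.
      by have := cardsD1 v (e :&: X); rewrite eX; case: (v \in _) => /=; lia.
    rewrite !inE => /and3P[nwv ew Xw]; exists w => //.
    by rewrite !inE nwv (EA_X e).
  have := INR_leq leW; rewrite !INR_muln => leWR.
  have leEA := Rle_trans _ _ _ EA_big leWR.
  apply: (Rmult_le_reg_r (2 * INR K)); first by lra.
  have -> : (c * INR #|U| / (2 * INR K) * (2 * INR K) = c * INR #|U|)%R by field; lra.
  by apply: (Rmult_le_reg_l (INR n)) => //; lra.
move=> I; rewrite !inE => /andP[/andP[indI _] /eqP EU] vI.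
apply/pred0P=> w /=; apply/negP=> /andP[wI].
rewrite !inE => /and3P[wA nwv /existsP[e /and3P[Ee ve we]]].
have Ce := EA_cross e Ee; have := Ce; rewrite inE => /and3P[He /eqP eX _].
move/forall_inP: indI => /(_ e He) /negP; apply.
(* The part of [e] in [X] is the pair [v], [w], and its part in [U] lies in [I], so [I] would
   contain [e]. *)
rewrite (cross_edgesU Ce) subUset; apply/andP; split; last first.
  by apply: subset_trans (subsetIr _ _) _; rewrite -EU subsetDl.
have /eqP <- : [set v; w] == e :&: X.
  rewrite eqEcard eX cards2 eq_sym nwv andbT.
  by apply/subsetP=> u; rewrite !inE => /orP[]/eqP->; rewrite ?ve ?we (subsetP sAX).
by apply/subsetP=> u; rewrite !inE => /orP[]/eqP->.
Qed.

(** The exposure starts with [U] selected and all else outside [X] rejected, so the free vertices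
    are those of [X] and all [T] exposures are available. Then [bin_tilt] trades [(1 + y) ^ b] for
    the binomial coefficient. *)
Lemma card_sets_over b : let y := (INR m / INR (b - m).+1)%R in
  (0 < c)%R -> 0 < n -> 0 < K -> 0 < #|U| -> (INR T * INR K <= c * INR n / 2)%R ->
  0 < m -> m <= b -> #|X| <= b ->
  (INR #|sets_over H m X U| <= INR b.+1 * INR 'C(b, m) *
     (y ^ #|U| * decay (y / (1 + y)) (c * INR #|U| / (2 * INR K)) ^ T))%R.
Proof.
move=> y c0 n0 K0 U0 leT m0 le_mb le_Xb.
have y0 : (0 < y)%R by apply: Rdiv_lt_0_compat; apply: lt_0_INR; lia.
pose N := ~: X :\: U.
have disUN : [disjoint U & N] by rewrite disjoint_sym -setI_eq0 setIDAC setDIl setDv setI0.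
have freeX : ~: (U :|: N) = X.
  apply/setP=> u; rewrite !inE.
  by case: (boolP (u \in U)) => [/(disjointFr disUX)->|_]; case: (u \in X).
have K0R : (0 < INR K)%R by apply: lt_0_INR; lia.
have kap0 : (0 <= c * INR #|U| / (2 * INR K))%R.
  by apply: Rle_mult_inv_pos; [apply: Rmult_le_pos; [lra|apply: pos_INR]|lra].
have cardF I : I \in sets_over H m X U -> #|I| = m.
  by rewrite !inE => /andP[/andP[_ /eqP]].
have := @cnt_sparse n _ X T m y _ y0 kap0 cardF
  (fun A => sets_over_conflict c0 n0 K0 U0 leT) T U N disUN.
rewrite freeX setDv cards0 => /(_ (subxx _) (or_intror (leqnn _))).
have -> : cnt (sets_over H m X U) U N = #|sets_over H m X U|.
  apply: eq_card => I; rewrite inE; have [|//] := boolP (I \in _).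
  rewrite !inE => /andP[_ /eqP EU] /=; have -> : U \subset I by rewrite -EU subsetDl.
  apply/pred0P=> u /=; apply/negP=> /andP[uI]; rewrite !inE -EU !inE uI.
  by case: (u \in X).
set r := (decay _ _ ^ T)%R => h.
have ym : (0 < y ^ m)%R by apply: pow_lt.
have yU : (0 < y ^ #|U|)%R by apply: pow_lt.
have r0 : (0 <= r)%R.
  by have := decay_bounds (tilt_prob_bounds y0) kap0 => ?; apply: pow_le; lra.
apply: (Rmult_le_reg_r (y ^ m)) => //; apply: Rle_trans h _.
have := bin_tilt le_mb; rewrite -/y => tilt.
have le1 : ((1 + y) ^ #|X| <= (1 + y) ^ b)%R by apply: Rle_pow; [lra|lia].
have -> : (INR b.+1 * INR 'C(b, m) * (y ^ #|U| * r) * y ^ m =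
  y ^ #|U| * (INR b.+1 * (INR 'C(b, m) * y ^ m)) * r)%R by ring.
apply: Rmult_le_compat_r => //; apply: Rmult_le_compat_l; first lra.
by apply: Rle_trans tilt.
Qed.

End NearSets.

Lemma INR_sum_le (I : finType) (P : pred I) (f : I -> nat) (M : R) :
  (forall i, P i -> (INR (f i) <= M)%R) ->
  (INR (\sum_(i | P i) f i) <= INR #|P| * M)%R.
Proof.
move=> le_fM; rewrite -sum1_card.
elim/big_rec2: _ => [|i s1 s2 Pi IH]; first by rewrite INR_0; lra.
by rewrite !INR_addn INR_1; have := le_fM i Pi; lra.
Qed.

Lemma card_near_sets n (H : hgraph n) m (X : {set 'I_n}) k (M : R) :
  (forall U : {set 'I_n}, [disjoint U & X] -> #|U| = k ->
     (INR #|sets_over H m X U| <= M)%R) -> (0 <= M)%R ->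
  (INR #|[set I in indep_sets H m | #|I :\: X| == k]| <= INR 'C(n, k) * M)%R.
Proof.
move=> leM M0; pose P := [pred U : {set 'I_n} | [disjoint U & X] && (#|U| == k)].
apply: (@Rle_trans _ (INR (\sum_(U | P U) #|sets_over H m X U|))).
  apply: INR_leq; apply: leq_trans (card_bigcup_le _ _).
  apply/subset_leq_card/subsetP=> I; rewrite inE => /andP[indI cardI].
  apply/bigcupP; exists (I :\: X); last by rewrite inE indI eqxx.
  rewrite inE cardI andbT; apply/pred0P=> u /=.
  by rewrite !inE; case: (u \in X); rewrite ?andbF.
apply: Rle_trans (INR_sum_le _) _; first by move=> U /andP[disU /eqP cU]; apply: leM disU cU.
apply: Rmult_le_compat_r => //; apply: INR_leq.
rewrite -[X in 'C(X, _)](card_ord n) -card_draws; apply/subset_leq_card/subsetP=> U.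
by rewrite !inE => /andP[].
Qed.

Lemma exp_mul_INR n (x : R) : exp (INR n * x) = (exp x ^ n)%R.
Proof.
elim: n => [|n IH]; first by rewrite INR_0 Rmult_0_l exp_0.
by rewrite S_INR Rmult_plus_distr_r Rmult_1_l exp_plus IH /= Rmult_comm.
Qed.

Lemma pow_le_exp n (y : R) : (0 <= 1 + y)%R -> ((1 + y) ^ n <= exp (INR n * y))%R.
Proof.
move=> y0; rewrite exp_mul_INR; apply: pow_incr; split=> //.
exact: exp_ineq1_le.
Qed.

(** The left side is one term of the expansion of [(1 + k / n) ^ n], which is at most [exp k]; it is
    read off [cnt_weight] for the family of all [k]-sets. *)
Lemma bin_le_exp n k : 0 < k -> 0 < n ->
  (INR 'C(n, k) * (INR k / INR n) ^ k <= exp (INR k))%R.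
Proof.
move=> k0 n0; have y0 : (0 < INR k / INR n)%R by apply: Rdiv_lt_0_compat; apply: lt_0_INR; lia.
pose F := [set I : {set 'I_n} | #|I| == k].
have leM I : I \in F -> ((INR k / INR n) ^ k <=
    (INR k / INR n) ^ #|I| * 1 ^ #|I :\: set0|)%R.
  by rewrite inE => /eqP->; rewrite pow1; lra.
have dis : [disjoint set0 & set0 : {set 'I_n}] by rewrite -setI_eq0 setI0.
have := cnt_weight y0 Rlt_0_1 leM dis.
rewrite cnt_setT card_draws card_ord setI0 cards0 !pow_O pow1 !Rmult_1_l !Rmult_1_r.
move=> h; apply: Rle_trans h _.
rewrite (_ : #|_ :\: _| = n); last first.
  by rewrite -[RHS]card_ord -cardsT; apply: eq_card => u; rewrite !inE.
have {2}-> : (INR k = INR n * (INR k / INR n))%R.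
  by field; apply: not_0_INR; lia.
by apply: pow_le_exp; lra.
Qed.

(** * Sets far from the family *)

(** A vertex of [I] outside [X] has [c * n] edges into [X], and each must miss [I] at a vertex of
    [X]. One vertex accounts for at most [K] of them, so [#|X :\: I|] is at least [c * n / K], twice
    the size allowed for [I :\: X]. *)
Lemma card_indep_escaping n (H : hgraph n) K (X I : {set 'I_n}) b (c : R) :
  uniform3 H -> Delta2 H <= K -> 0 < K -> #|X| <= b ->
  (forall v, v \notin X -> (c * INR n <= INR (deg_into H X v))%R) ->
  independent H I -> ~~ (I \subset X) ->
  (INR #|I :\: X| <= c / (2 * INR K) * INR n)%R ->
  (INR #|I| + c / (2 * INR K) * INR n <= INR b)%R.
Proof.
move=> H3 HK K0 leXb degX indI /subsetPn[v vI vX] leIX.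
have K0R : (0 < INR K)%R by apply: lt_0_INR; lia.
pose E : hgraph n := [set e in H | #|e :&: X| == 2].
have sEH : E \subset H by apply/subsetP=> e; rewrite inE => /andP[].
have deg_v : edeg E v <= #|X :\: I| * K.
  apply: leq_trans (edeg_le_nbrs (A := X :\: I) HK sEH _) _; last first.
    rewrite leq_mul2r; apply/orP; right; apply/subset_leq_card/subsetP=> u.
    by rewrite inE => /andP[].
  move=> e; rewrite inE => /andP[He /eqP eX] ve.
  have /subsetPn[w we wI] := forall_inP indI e He.
  have nwv : w != v by apply: contraNneq wI => ->.
  (* The missing vertex [w] lies in [X]: otherwise [v] and [w] would both be in [e :\: X], which has
     a single element. *)
  exists w => //; rewrite !inE nwv wI /=; apply: contraT => wX.
  have := cardsID X e; rewrite eX (H3 _ He) => cardD.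
  have : #|[set v; w]| <= #|e :\: X|.
    apply/subset_leq_card/subsetP=> u; rewrite !inE.
    by case/orP=> /eqP->; rewrite ?vX ?wX ?ve ?we.
  by rewrite cards2 eq_sym nwv; lia.
have Edeg : deg_into H X v = edeg E v by apply: eq_card => e; rewrite !inE andbA.
have le1 : (c * INR n <= INR #|X :\: I| * INR K)%R.
  by apply: Rle_trans (degX v vX) _; rewrite -INR_muln Edeg; apply: INR_leq.
have cI : (INR #|I| = INR #|I :&: X| + INR #|I :\: X|)%R by rewrite -INR_addn cardsID.
have cX : (INR #|I :&: X| + INR #|X :\: I| = INR #|X|)%R.
  by rewrite -INR_addn setIC cardsID.
have le2 : (c / INR K * INR n <= INR #|X :\: I|)%R.
  apply: (Rmult_le_reg_r (INR K)) => //; apply: Rle_trans le1; right; field; lra.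
have E2 : (c / INR K * INR n = 2 * (c / (2 * INR K) * INR n))%R by field; lra.
by have := INR_leq leXb; lra.
Qed.

Lemma exp_le_mono (x z : R) : (x <= z)%R -> (exp x <= exp z)%R.
Proof. by case=> [lt_xz|->]; [apply/Rlt_le/exp_increasing|right]. Qed.

(** Take reciprocals in [1 - p <= exp (- p)] for [p = y / (1 + y)], where [1 - p = 1 / (1 + y)]. *)
Lemma exp_tilt_le (y : R) : (0 < y)%R -> (exp (y / (1 + y)) <= 1 + y)%R.
Proof.
move=> y0; have := exp_ineq1_le (- (y / (1 + y))).
have -> : (1 + - (y / (1 + y)) = / (1 + y))%R by field; lra.
rewrite exp_Ropp => /Rinv_le_contravar; rewrite !Rinv_inv; apply.
by apply: Rinv_0_lt_compat; lra.
Qed.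

Lemma cnt_edge n (H : hgraph n) (F : {set {set 'I_n}}) (Y N e : {set 'I_n}) :
  (forall I, I \in F -> independent H I) -> e \in H -> e \subset Y -> cnt F Y N = 0.
Proof.
move=> indF He sEY; apply/eqP; rewrite cards_eq0; apply/eqP/setP=> I.
rewrite !inE; apply/negP=> /and3P[IF sYI _].
by have /forall_inP/(_ e He)/negP[] := indF I IF; apply: subset_trans sYI.
Qed.

(* The weight [lam * y] charged per selected vertex trades the cost
   [lam ^- q] of the at most [q] selections for a total [(1 + lam * y) ^ n]. *)
Lemma card_far_sets n (H : hgraph n) (Bn F : {set {set 'I_n}}) K tau d q b m
    (beta gamma delta kappa lam : R) : let y := (INR m / INR (b - m).+1)%R in
  uniform3 H -> Delta2 H <= K -> 0 < m -> m <= b ->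
  (forall a1 a2, a1 * d <= n * (tau + K) -> a2 * tau <= n * K -> a1 + a2 <= q) ->
  (forall A : {set 'I_n}, nedges_ind H A <= n * d ->
     (INR #|A| + beta * INR n <= INR b)%R \/
     exists2 X, X \in Bn & (INR #|A :\: X| <= gamma * INR n)%R) ->
  (forall X, X \in Bn -> #|X| <= b) ->
  (forall I, I \in F -> [/\ independent H I, #|I| = m &
     forall X, X \in Bn -> (delta * INR m <= INR #|I :\: X|)%R]) ->
  (0 < lam <= 1)%R -> (0 <= beta)%R ->
  (kappa * INR m <= y / (1 + y) * (beta * INR n))%R ->
  (exp 1 * y * (gamma * INR n) + kappa * INR m <= delta * INR m)%R ->
  (INR #|F| <= INR b.+1 * INR 'C(b, m) *
    (exp (INR q) * (/ lam) ^ q * exp (- (kappa * INR m)) * exp (INR n * (lam * y))))%R.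
Proof.
move=> y H3 HK m0 le_mb le_q leaf leB propF lam01 beta0 kap1 kap2.
have y0 : (0 < y)%R by apply: Rdiv_lt_0_compat; apply: lt_0_INR; lia.
have p01 := tilt_prob_bounds y0.
have ly0 : (0 < lam * y)%R by apply: Rmult_lt_0_compat; lra.
have := bin_tilt le_mb; rewrite -/y => tilt.
set C0 := (INR b.+1 * INR 'C(b, m))%R.
have C00 : (0 <= C0)%R by apply: Rmult_le_pos; apply: pos_INR.
pose M := (C0 * (exp (INR q) * (/ lam) ^ q * exp (- (kappa * INR m))))%R.
have ym : (0 < y ^ m)%R by apply: pow_lt.
have expq : (0 < exp (INR q))%R := exp_pos _.
have expk : (0 < exp (- (kappa * INR m)))%R := exp_pos _.
have lamq : (1 <= (/ lam) ^ q)%R.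
  by apply: pow_R1_Rle; rewrite -Rinv_1; apply: Rinv_le_contravar; lra.
have M0 : (0 <= M)%R.
  apply: Rmult_le_pos => //; apply: Rmult_le_pos; last lra.
  by apply: Rmult_le_pos; lra.
(* Branching preserves this bound because a free vertex carries [1 + lam * y]: the [1] goes to its
   rejection and [lam * y] to its selection. *)
pose G (Y N : {set 'I_n}) := [disjoint Y & N] ->
  (INR (cnt F Y N) <= M * (lam * y) ^ #|Y| * (1 + lam * y) ^ #|~: (Y :|: N)|)%R.
have dis0 : [disjoint set0 & set0 : {set 'I_n}] by rewrite -setI_eq0 setI0.
have bnd0 Y k : (0 <= M * (lam * y) ^ Y * (1 + lam * y) ^ k)%R.
  by apply: Rmult_le_pos; [apply: Rmult_le_pos => //|]; apply: pow_le; lra.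
suff : G set0 set0.
  move/(_ dis0); rewrite cnt_setT cards0 pow_O Rmult_1_r => h.
  apply: Rle_trans h _; rewrite -Rmult_assoc; apply: Rmult_le_compat_l => //.
  rewrite (_ : #|~: _| = n); last by rewrite setU0 setC0 cardsT card_ord.
  by apply: pow_le_exp; lra.
apply: (@container n H K tau d G H3 HK).
- move=> Y N v nY nN G1 G2 disYN.
  have Av : v \in ~: (Y :|: N) by rewrite !inE negb_or nY.
  have [disv1 disv2] := disjoint_U1 Av disYN.
  rewrite (cnt_split _ _ _ v) INR_addn.
  apply: Rle_trans (Rplus_le_compat _ _ _ _ (G1 disv1) (G2 disv2)) _; right.
  rewrite free_U1l free_U1r (cardsD1 v (~: (Y :|: N))) Av add1n cardsU1 nY add1n.
  by rewrite -!tech_pow_Rmult; ring.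
- move=> Y N e He sEY disYN; rewrite (cnt_edge N _ He sEY) ?INR_0 //.
  by move=> I /propF[].
move=> W W1 N; set Y := W :|: W1 => disYN leW leW1 edgeA.
have leYq : #|Y| <= q by apply: leq_trans (leq_card_setU _ _) _; apply: le_q.
suff leafY : (INR (cnt F Y N) <= C0 * (y ^ #|Y| * exp (INR q) * exp (- (kappa * INR m))))%R.
  move=> _; apply: Rle_trans leafY _.
  have one : (1 <= (1 + lam * y) ^ #|~: (Y :|: N)|)%R by apply: pow_R1_Rle; lra.
  rewrite -[X in (X <= _)%R]Rmult_1_r; apply: (Rmult_le_compat _ _ _ _ _ _ _ one).
  - apply: Rmult_le_pos => //; apply: Rmult_le_pos; last lra.
    by apply: Rmult_le_pos; [apply: pow_le|]; lra.
  - by lra.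
  have ylam : (y ^ #|Y| <= (/ lam) ^ q * (lam * y) ^ #|Y|)%R.
    have -> : (y ^ #|Y| = (/ lam) ^ #|Y| * (lam * y) ^ #|Y|)%R.
      by rewrite -Rpow_mult_distr; congr (_ ^ _)%R; field; lra.
    apply: Rmult_le_compat_r; first by apply: pow_le; lra.
    apply: Rle_pow; last by lia.
    by rewrite -Rinv_1; apply: Rinv_le_contravar; lra.
  rewrite /M [X in (_ <= X)%R]Rmult_assoc; apply: Rmult_le_compat_l => //.
  have -> : (exp (INR q) * (/ lam) ^ q * exp (- (kappa * INR m)) * (lam * y) ^ #|Y| =
    ((/ lam) ^ q * (lam * y) ^ #|Y|) * exp (INR q) * exp (- (kappa * INR m)))%R by ring.
  apply: Rmult_le_compat_r; first lra.
  by apply: Rmult_le_compat_r; first lra.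
rewrite {M M0 bnd0 G}; set A := ~: (Y :|: N) in edgeA *.
have yY : (0 < y ^ #|Y|)%R by apply: pow_lt.
have expq1 : (1 <= exp (INR q))%R.
  by have := exp_ineq1_le (INR q); have := pos_INR q; lra.
(* If [A] is smaller than [b] by [beta * n], then [(1 + y) ^ #|A|] is smaller than [(1 + y) ^ b] by
   a factor of at least [exp (kappa * m)]. *)
have [smallA|[X BX leAX]] := leaf A edgeA.
  have leM I : I \in F -> (y ^ m <= y ^ #|I| * 1 ^ #|I :\: setT|)%R.
    by case/propF=> _ -> _; rewrite pow1; lra.
  have := cnt_weight y0 Rlt_0_1 leM disYN; rewrite -/A setIT !pow1.
  rewrite (_ : #|A :\: setT| = 0) ?pow_O; last by rewrite setDT cards0.
  rewrite !Rmult_1_r => h.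
  have leAb : #|A| <= b.
    have : (0 <= beta * INR n)%R by apply: Rmult_le_pos => //; apply: pos_INR.
    by move=> ?; apply/leP/INR_le; lra.
  have gain : ((1 + y) ^ #|A| * exp (kappa * INR m) <= (1 + y) ^ b)%R.
    have -> : ((1 + y) ^ b = (1 + y) ^ #|A| * (1 + y) ^ (b - #|A|))%R.
      by rewrite -Rdef_pow_add plusE subnKC.
    apply: Rmult_le_compat_l; first by apply: pow_le; lra.
    apply: (@Rle_trans _ (exp (INR (b - #|A|) * (y / (1 + y))))).
      apply: exp_le_mono; apply: Rle_trans kap1 _; rewrite Rmult_comm.
      apply: Rmult_le_compat_r; first lra.
      by rewrite minus_INR; [lra|apply/leP].
    rewrite exp_mul_INR; apply: pow_incr; split; first exact/Rlt_le/exp_pos.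
    exact: exp_tilt_le.
  apply: (Rmult_le_reg_r (y ^ m)) => //; apply: Rle_trans h _.
  have E1 : (exp (kappa * INR m) * exp (- (kappa * INR m)) = 1)%R.
    by rewrite -exp_plus Rplus_opp_r exp_0.
  have -> : (y ^ #|Y| * (1 + y) ^ #|A| = y ^ #|Y| *
     ((1 + y) ^ #|A| * exp (kappa * INR m)) * exp (- (kappa * INR m)))%R.
    by rewrite -[LHS]Rmult_1_r -E1; ring.
  have -> : (C0 * (y ^ #|Y| * exp (INR q) * exp (- (kappa * INR m))) * y ^ m =
     y ^ #|Y| * (C0 * y ^ m * exp (INR q)) * exp (- (kappa * INR m)))%R by ring.
  apply: Rmult_le_compat_r; first lra.
  apply: Rmult_le_compat_l; first lra.
  apply: Rle_trans gain _; apply: Rle_trans tilt _; rewrite -Rmult_assoc -/C0.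
  rewrite -[X in (X <= _)%R]Rmult_1_r; apply: Rmult_le_compat_l => //.
  by apply: Rmult_le_pos; lra.
(* Now [A] almost lies in [X]. A weight [exp 1] per vertex outside [X] gains [exp (delta * m)], as
   the sets are far from [X], and loses little, as few selected or free vertices are outside [X]. *)
have w0 : (0 < exp 1)%R := exp_pos 1.
have powe j : (exp 1 ^ j = exp (INR j))%R by rewrite -exp_mul_INR Rmult_1_r.
have leM I : I \in F -> (y ^ m * exp (delta * INR m) <= y ^ #|I| * exp 1 ^ #|I :\: X|)%R.
  case/propF=> _ -> /(_ X BX) far; apply: Rmult_le_compat_l; first lra.
  by rewrite powe; apply: exp_le_mono.
have := cnt_weight y0 w0 leM disYN; rewrite -/A => h.
have le1 : (exp 1 ^ #|Y :\: X| <= exp (INR q))%R.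
  rewrite powe; apply/exp_le_mono/INR_leq; apply: leq_trans leYq.
  exact/subset_leq_card/subsetDl.
have le2 : ((1 + y) ^ #|A :&: X| <= C0 * y ^ m)%R.
  rewrite /C0 Rmult_assoc; apply: Rle_trans tilt; apply: Rle_pow; first lra.
  apply/leP; apply: leq_trans (leB X BX); apply/subset_leq_card/subsetIr.
have le3 : ((1 + y * exp 1) ^ #|A :\: X| <= exp (delta * INR m) * exp (- (kappa * INR m)))%R.
  have yw : (0 < y * exp 1)%R by apply: Rmult_lt_0_compat.
  apply: Rle_trans (pow_le_exp _ _) _; first lra.
  rewrite -exp_plus; apply: exp_le_mono.
  have : (INR #|A :\: X| * (y * exp 1) <= gamma * INR n * (y * exp 1))%R.
    by apply: Rmult_le_compat_r; lra.
  by lra.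
have expd : (0 < exp (delta * INR m))%R := exp_pos _.
apply: (Rmult_le_reg_r (y ^ m * exp (delta * INR m))); first exact: Rmult_lt_0_compat.
apply: Rle_trans h _.
have -> : (C0 * (y ^ #|Y| * exp (INR q) * exp (- (kappa * INR m))) *
    (y ^ m * exp (delta * INR m)) = y ^ #|Y| * exp (INR q) *
    ((C0 * y ^ m) * (exp (delta * INR m) * exp (- (kappa * INR m)))))%R by ring.
apply: Rmult_le_compat.
- by apply: Rmult_le_pos; [lra|apply: pow_le; lra].
- by apply: Rmult_le_pos; apply: pow_le; [lra|have := Rmult_lt_0_compat _ _ y0 w0; lra].
- by apply: Rmult_le_compat_l; lra.
apply: Rmult_le_compat => //; apply: pow_le; first lra.
by have := Rmult_lt_0_compat _ _ y0 w0; lra.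
Qed.

(** * Asymptotic estimates *)

Lemma ln_le_mono (x z : R) : (0 < x)%R -> (x <= z)%R -> (ln x <= ln z)%R.
Proof. by move=> x0 [lt_xz|->]; [apply/Rlt_le/ln_increasing|right]. Qed.

Lemma ln_inv_ge0 (x : R) : (0 < x <= 1)%R -> (0 <= ln (/ x))%R.
Proof.
move=> x01; rewrite -ln_1; apply: ln_le_mono; first lra.
by rewrite -Rinv_1; apply: Rinv_le_contravar; lra.
Qed.

Lemma ln_le_sqrt (x : R) : (0 < x)%R -> (ln x <= 2 * sqrt x)%R.
Proof.
move=> x0; have s0 : (0 < sqrt x)%R by apply: sqrt_lt_R0.
have -> : (ln x = 2 * ln (sqrt x))%R.
  by rewrite -{1}(sqrt_sqrt x) ?ln_mult //; lra.
have := exp_ineq1_le (ln (sqrt x)); rewrite exp_ln //; lra.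
Qed.

Lemma eventually_le_INR (a : R) :
  exists N : nat, forall n : nat, N <= n -> (a <= INR n)%R.
Proof.
have [N aN] := INR_unbounded a; exists N => n /INR_leq; lra.
Qed.

Lemma eventually_le_ln (a : R) :
  exists N : nat, forall n : nat, N <= n -> (a <= ln (INR n))%R.
Proof.
have [N leN] := eventually_le_INR (exp a); exists N => n /leN le_n.
by rewrite -(ln_exp a); apply: ln_le_mono => //; apply: exp_pos.
Qed.

Lemma eventually_ln_le_sqrt (a : R) :
  exists N : nat, forall n : nat, N <= n -> (a * ln (INR n) <= sqrt (INR n))%R.
Proof.
(* For [r] the fourth root of [n], [ln n <= 4 * r], so it suffices that [r] is at least
   [4 * Rabs a]. *)
have [N1 leN1] := eventually_le_INR ((4 * Rabs a) * (4 * Rabs a) * ((4 * Rabs a) * (4 * Rabs a)))%R.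
have [N2 leN2] := eventually_le_INR 1.
exists (maxn N1 N2) => n; rewrite geq_max => /andP[/leN1 n1 /leN2 n2].
have a0 := Rabs_pos a.
set s := sqrt (INR n); have s1 : (1 <= s)%R by rewrite -sqrt_1; apply: sqrt_le_1; lra.
have ss : (s * s = INR n)%R by apply: sqrt_sqrt; lra.
set r := sqrt s; have rr : (r * r = s)%R by apply: sqrt_sqrt; lra.
have r0 : (0 <= r)%R by apply: sqrt_pos.
have lnn : (ln (INR n) <= 4 * r)%R.
  rewrite -ss ln_mult; try lra.
  by have := @ln_le_sqrt s; rewrite -/r; lra.
have ln0 : (0 <= ln (INR n))%R by rewrite -ln_1; apply: ln_le_mono; lra.
have ar : (4 * Rabs a <= r)%R.
  have h1 : (4 * Rabs a * (4 * Rabs a) <= s)%R.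
    by apply: Rsqr_incr_0; rewrite /Rsqr; [rewrite ss; lra|nra|lra].
  by apply: Rsqr_incr_0; rewrite /Rsqr; [rewrite rr; lra|nra|lra].
have := Rle_abs a => aa.
apply: (@Rle_trans _ (Rabs a * ln (INR n))%R); first by apply: Rmult_le_compat_r.
apply: (@Rle_trans _ (Rabs a * (4 * r))%R); first by apply: Rmult_le_compat_l.
by rewrite -rr; nra.
Qed.

Lemma INR_succ_le_exp (n b : nat) :
  b <= n -> 0 < n -> (1 <= ln (INR n))%R -> (INR b.+1 <= exp (2 * ln (INR n)))%R.
Proof.
move=> le_bn n0 ln1; have n0R : (0 < INR n)%R by apply: lt_0_INR; lia.
have -> : (2 * ln (INR n) = ln (INR n) + ln (INR n))%R by ring.
rewrite exp_plus exp_ln ?S_INR //.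
have n2 : (2 <= INR n)%R by have := exp_ineq1_le (ln (INR n)); rewrite exp_ln; lra.
by have := INR_leq le_bn; nra.
Qed.

(** The choice of [y] makes [y / (1 + y)] equal to [m / (b + 1)]. *)
Lemma tilt_prob_ge (n b m : nat) : 0 < m -> m <= b -> b <= n ->
  let y := (INR m / INR (b - m).+1)%R in (INR m / (2 * INR n) <= y / (1 + y))%R.
Proof.
move=> m0 le_mb le_bn y.
have w0 : (0 < INR (b - m).+1)%R by apply: lt_0_INR; lia.
have m1 : (1 <= INR m)%R by have := INR_leq m0; rewrite INR_1.
have -> : (y / (1 + y) = INR m / (INR b + 1))%R.
  have : (INR (b - m).+1 + INR m = INR b + 1)%R.
    by rewrite -INR_addn -S_INR; congr INR; lia.
  by move=> <-; rewrite /y; field; lra.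
apply: Rmult_le_compat_l; first lra.
have := INR_leq le_bn; have := INR_leq le_mb => ? ?.
by apply: Rinv_le_contravar; lra.
Qed.

(* The minimum separates two regimes. If [c1 k m >= n], the decay is
   [exp (- eps m / 32)], which beats [(m / k) ^ k] because [k <= delta m]; otherwise
   it is [n ^ (- (lc + 4) k)], since [m ^ 2 / n >= C ^ 2 ln n]. *)
Lemma near_exponent (n m k c0 c1 eps C lc delta : R) :
  (1 <= k -> k <= delta * m -> 0 < m -> m <= n -> 0 < c0 <= 1 -> 0 < c1 ->
  0 < eps -> 0 < delta -> 0 <= lc ->
  delta * (1 + ln (/ c0)) <= eps / 128 -> delta <= (eps / 256) * (eps / 256) ->
  C * C * (n * ln n) <= m * m -> lc + 4 <= eps * c1 * (C * C) / 32 ->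
  1 + ln (/ c0) <= ln n -> 64 * (lc + 2) / eps * ln n <= m ->
  k * (1 + ln (/ c0) + ln (m / k)) + 2 * ln n
    - eps * m / 32 * Rmin 1 (c1 * k * m / n) <= - (lc * ln n))%R.
Proof.
move=> k1 k_dm m0 mn c01 c10 eps0 delta0 lc0 del1 del2 mm CC lnn lnm.
have lc00 : (0 <= ln (/ c0))%R by apply: ln_inv_ge0.
have mk0 : (0 < m / k)%R by apply: Rdiv_lt_0_compat; lra.
have [ge1|lt1] := Rle_lt_dec 1 (c1 * k * m / n).
  rewrite Rmin_left //.
  (* With [s = sqrt (m / k)], the bound [k <= delta * m] gives [s >= 256 / eps], whence
     [ln (m / k) <= 2 * s <= eps / 128 * s ^ 2]. *)
  have kln : (k * ln (m / k) <= eps / 128 * m)%R.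
    apply: (@Rle_trans _ (k * (2 * sqrt (m / k)))%R).
      by apply: Rmult_le_compat_l; [lra|apply: ln_le_sqrt].
    have s0 := sqrt_pos (m / k); have ss := sqrt_sqrt (m / k) (Rlt_le _ _ mk0).
    set s := sqrt (m / k) in s0 ss *.
    have ms : (m = k * (s * s))%R by rewrite ss; field; lra.
    have s1 : (256 / eps <= s)%R.
      have : (1 <= delta * (s * s))%R.
        by apply: (Rmult_le_reg_l k); [lra|rewrite ms in k_dm; lra].
      move=> h; apply: Rsqr_incr_0; rewrite /Rsqr; try lra; last first.
        by apply: Rle_mult_inv_pos; lra.
      apply: (Rmult_le_reg_l ((eps / 256) * (eps / 256))).
        by apply: Rmult_lt_0_compat; lra.
      have -> : (eps / 256 * (eps / 256) * (256 / eps * (256 / eps)) = 1)%R by field; lra.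
      by apply: Rle_trans h _; apply: Rmult_le_compat_r => //; nra.
    have s2 : (256 <= eps * s)%R.
      have -> : (256 = eps * (256 / eps))%R by field; lra.
      by apply: Rmult_le_compat_l; lra.
    have ks : (0 <= k * s)%R by apply: Rmult_le_pos; lra.
    rewrite [X in (_ <= _ * X)%R]ms.
    have -> : (eps / 128 * (k * (s * s)) = k * s * (eps * s) / 128)%R by field.
    by nra.
  have kc : (k * (1 + ln (/ c0)) <= eps / 128 * m)%R.
    apply: (@Rle_trans _ (delta * m * (1 + ln (/ c0)))%R).
      by apply: Rmult_le_compat_r; lra.
    have -> : (delta * m * (1 + ln (/ c0)) = delta * (1 + ln (/ c0)) * m)%R by ring.
    by apply: Rmult_le_compat_r; lra.
  have : ((lc + 2) * ln n <= eps / 64 * m)%R.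
    apply: (Rmult_le_reg_l (64 / eps)); first by apply: Rdiv_lt_0_compat; lra.
    have -> : (64 / eps * (eps / 64 * m) = m)%R by field; lra.
    by apply: Rle_trans lnm; right; field; lra.
  by nra.
rewrite Rmin_right; last lra.
have n0 : (0 < n)%R by lra.
have lnmk : (ln (m / k) <= ln n)%R.
  apply: ln_le_mono => //; apply: (Rmult_le_reg_r k); first lra.
  have -> : (m / k * k = m)%R by field; lra.
  by nra.
have dec : ((lc + 4) * (k * ln n) <= eps * m / 32 * (c1 * k * m / n))%R.
  have -> : (eps * m / 32 * (c1 * k * m / n) = eps * c1 * k / 32 * (m * m / n))%R by field; lra.
  have mn2 : (C * C * ln n <= m * m / n)%R.
    apply: (Rmult_le_reg_r n) => //.
    have -> : (m * m / n * n = m * m)%R by field; lra.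
    by lra.
  apply: (@Rle_trans _ (eps * c1 * k / 32 * (C * C * ln n))%R).
    have -> : (eps * c1 * k / 32 * (C * C * ln n) = eps * c1 * (C * C) / 32 * (k * ln n))%R by field.
    by apply: Rmult_le_compat_r => //; nra.
  apply: Rmult_le_compat_l => //.
  have := Rmult_lt_0_compat _ _ eps0 c10; nra.
have : (k * (1 + ln (/ c0) + ln (m / k)) <= 2 * (k * ln n))%R by nra.
have : (ln n <= k * ln n)%R by nra.
by nra.
Qed.

(** Combine [1 - u <= exp (- u)] with [x / (4 * (1 + x)) >= Rmin 1 x / 8]. *)
Lemma decay_pow_le (p kappa x1 t : R) (T : nat) :
  (0 < p < 1 -> 0 <= x1 -> x1 <= kappa * p -> 0 <= kappa -> t <= INR T * p ->
   decay p kappa ^ T <= exp (- (t / 8 * Rmin 1 x1)))%R.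
Proof.
move=> p01 x10 x1k k0 le_t.
have := decay_bounds p01 k0; rewrite /decay; set x := (kappa * p)%R in x1k *.
set th := (x / (4 * (1 + x)))%R => rho.
apply: Rle_trans (pow_le_exp _ _) _; first lra.
apply: exp_le_mono; rewrite -Ropp_mult_distr_r; apply: Ropp_le_contravar.
have th8 : (Rmin 1 x1 / 8 <= th)%R.
  apply: (Rmult_le_reg_r (8 * (1 + x))); first lra.
  have -> : (th * (8 * (1 + x)) = 2 * x)%R by rewrite /th; field; lra.
  have := Rmin_l 1 x1; have := Rmin_r 1 x1; nra.
have m0 : (0 <= Rmin 1 x1)%R by apply: Rmin_glb; lra.
have Tp : (0 <= INR T * p)%R by apply: Rmult_le_pos; [apply: pos_INR|lra].
apply: (@Rle_trans _ (INR T * p * (Rmin 1 x1 / 8))%R); first by nra.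
by rewrite -Rmult_assoc; apply: Rmult_le_compat_l.
Qed.

(** The choices of [U] cost what [bin_le_exp] and [y <= m / (c0 * n)] allow, [b.+1] costs
    [exp (2 * ln n)], and the exposures gain the decay at a vertex probability of at least
    [m / (2 * n)]; [near_exponent] balances the three. *)
Lemma near_term (n b m k T K : nat) (c0 c eps C lc delta : R) :
  let y := (INR m / INR (b - m).+1)%R in
  0 < k -> 0 < m -> m <= b -> b <= n -> 0 < K ->
  (c0 * INR n <= INR (b - m).+1 -> INR k <= delta * INR m ->
  0 < c0 <= 1 -> 0 < c -> 0 < eps -> 0 < delta -> 0 <= lc ->
  eps * INR n / 2 <= INR T ->
  delta * (1 + ln (/ c0)) <= eps / 128 -> delta <= (eps / 256) * (eps / 256) ->
  C * C * (INR n * ln (INR n)) <= INR m * INR m ->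
  lc + 4 <= eps * (c / (4 * INR K)) * (C * C) / 32 ->
  1 + ln (/ c0) <= ln (INR n) -> 64 * (lc + 2) / eps * ln (INR n) <= INR m ->
  INR 'C(n, k) * (INR b.+1 *
    (y ^ k * decay (y / (1 + y)) (c * INR k / (2 * INR K)) ^ T)) <=
  exp (- (lc * ln (INR n))))%R.
Proof.
move=> y k0 m0 le_mb le_bn K0 c0b k_dm c01 c_0 eps0 del0 lc0 Teps del1 del2 mm CC lnn lnm.
have pos j : 0 < j -> (1 <= INR j)%R by move=> j0; have := INR_leq j0; rewrite INR_1.
have k1 := pos k k0; have m1 := pos m m0; have K1 := pos K K0.
have mnR : (INR m <= INR n)%R by apply/INR_leq/(leq_trans le_mb).
have bn := INR_leq le_bn; have mb := INR_leq le_mb.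
have n1 : (1 <= INR n)%R by lra.
have w1 := pos (b - m).+1 (ltn0Sn _).
have y0 : (0 < y)%R by apply: Rdiv_lt_0_compat; lra.
have p01 := tilt_prob_bounds y0.
have lnc : (0 <= ln (/ c0))%R by apply: ln_inv_ge0.
have p_ge : (INR m / (2 * INR n) <= y / (1 + y))%R := tilt_prob_ge m0 le_mb le_bn.
have mk0 : (0 < INR m / INR k)%R by apply: Rdiv_lt_0_compat; lra.
have le1 : (INR 'C(n, k) * y ^ k <= exp (INR k * (1 + ln (/ c0) + ln (INR m / INR k))))%R.
  have y_le : (y <= (INR k / INR n) * (INR m / INR k * / c0))%R.
    have -> : (INR k / INR n * (INR m / INR k * / c0) = INR m / (c0 * INR n))%R by field; lra.
    apply: Rmult_le_compat_l; first lra.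
    by apply: Rinv_le_contravar; nra.
  apply: (@Rle_trans _ (INR 'C(n, k) * ((INR k / INR n) * (INR m / INR k * / c0)) ^ k)%R).
    by apply: Rmult_le_compat_l; [apply: pos_INR|apply: pow_incr; lra].
  rewrite Rpow_mult_distr -Rmult_assoc.
  have -> : (INR k * (1 + ln (/ c0) + ln (INR m / INR k)) =
     INR k + INR k * (ln (INR m / INR k) + ln (/ c0)))%R by ring.
  have ic0 : (0 < / c0)%R by apply: Rinv_0_lt_compat; lra.
  rewrite exp_plus exp_mul_INR exp_plus !exp_ln //.
  apply: Rmult_le_compat_r; first by apply: pow_le; nra.
  by apply: bin_le_exp => //; lia.
have le2 : (INR b.+1 <= exp (2 * ln (INR n)))%R.
  by apply: INR_succ_le_exp => //; [lia|lra].
have le3 : (decay (y / (1 + y)) (c * INR k / (2 * INR K)) ^ T <=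
    exp (- (eps * INR m / 32 * Rmin 1 (c / (4 * INR K) * INR k * INR m / INR n))))%R.
  have -> : (eps * INR m / 32 = (eps * INR m / 4) / 8)%R by field.
  apply: decay_pow_le => //.
  - apply: Rle_mult_inv_pos; last lra.
    repeat (apply: Rmult_le_pos; last lra).
    by apply: Rle_mult_inv_pos; lra.
  - have -> : (c / (4 * INR K) * INR k * INR m / INR n =
       c * INR k / (2 * INR K) * (INR m / (2 * INR n)))%R by field; lra.
    by apply: Rmult_le_compat_l => //; apply: Rle_mult_inv_pos; nra.
  - by apply: Rle_mult_inv_pos; nra.
  - have -> : (eps * INR m / 4 = eps * INR n / 2 * (INR m / (2 * INR n)))%R by field; lra.
    have h0 : (0 <= INR m / (2 * INR n))%R by apply: Rle_mult_inv_pos; lra.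
    by apply: Rmult_le_compat => //; nra.
have c10 : (0 < c / (4 * INR K))%R by apply: Rdiv_lt_0_compat; lra.
have m0R : (0 < INR m)%R by lra.
have := near_exponent k1 k_dm m0R mnR c01 c10 eps0 del0 lc0 del1 del2 mm CC lnn lnm.
move/exp_le_mono; apply: Rle_trans.
have -> : (INR k * (1 + ln (/ c0) + ln (INR m / INR k)) + 2 * ln (INR n) -
   eps * INR m / 32 * Rmin 1 (c / (4 * INR K) * INR k * INR m / INR n) =
   INR k * (1 + ln (/ c0) + ln (INR m / INR k)) + (2 * ln (INR n) +
   - (eps * INR m / 32 * Rmin 1 (c / (4 * INR K) * INR k * INR m / INR n))))%R by ring.
rewrite 2!exp_plus.
set D := (decay _ _ ^ T)%R in le3 *.
have -> : (INR 'C(n, k) * (INR b.+1 * (y ^ k * D)) = INR 'C(n, k) * y ^ k * (INR b.+1 * D))%R by ring.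
have D0 : (0 <= D)%R.
  have kk : (0 <= c * INR k / (2 * INR K))%R by apply: Rle_mult_inv_pos; nra.
  by have := decay_bounds p01 kk => ?; apply: pow_le; lra.
apply: Rmult_le_compat => //.
- by apply: Rmult_le_pos; [apply: pos_INR|apply: pow_le; lra].
- by apply: Rmult_le_pos; [apply: pos_INR|].
by apply: Rmult_le_compat => //; apply: pos_INR.
Qed.

Lemma nat_floor (x : R) : (0 <= x)%R -> exists k : nat, (INR k <= x < INR k + 1)%R.
Proof.
move=> x0; have [k1 k2] := archimed x.
have z0 : (0 < up x)%Z by apply: lt_IZR; lra.
have [|k Ek] := IZN (up x - 1); first by lia.
by exists k; rewrite INR_IZR_INZ -Ek minus_IZR; lra.
Qed.

(** Of the gain [kappa * m], the selections use at most a quarter and [exp (n * lam * y)] at most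
    half. The last quarter is at least [3 * ln n], of which [b.+1] takes [2 * ln n]. *)
Lemma far_term (n b m q : nat) (c0 kappa lam : R) :
  let y := (INR m / INR (b - m).+1)%R in
  (0 < n)%N -> (b <= n)%N ->
  (c0 * INR n <= INR (b - m).+1 -> 0 < c0 -> 0 < lam -> lam <= kappa * c0 / 2 ->
   1 <= ln (INR n) -> INR q * (1 + ln (/ lam)) <= kappa / 4 * INR m ->
   12 * ln (INR n) <= kappa * INR m ->
   INR b.+1 * (exp (INR q) * (/ lam) ^ q * exp (- (kappa * INR m)) *
     exp (INR n * (lam * y))) <= exp (- ln (INR n)))%R.
Proof.
move=> y n0 le_bn c0b c00 lam0 lam_le ln1 q_le ln_le.
have n1 : (1 <= INR n)%R by have := INR_leq n0; rewrite INR_1.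
have w0 : (0 < c0 * INR n)%R by apply: Rmult_lt_0_compat; lra.
have y_le : (INR n * (lam * y) <= kappa / 2 * INR m)%R.
  apply: (@Rle_trans _ (INR n * (lam * (INR m / (c0 * INR n))))%R).
    apply: Rmult_le_compat_l; first lra.
    apply: Rmult_le_compat_l; first lra.
    apply: Rmult_le_compat_l; first exact: pos_INR.
    exact: Rinv_le_contravar.
  have -> : (INR n * (lam * (INR m / (c0 * INR n))) = lam / c0 * INR m)%R by field; lra.
  apply: Rmult_le_compat_r; first exact: pos_INR.
  apply: (Rmult_le_reg_r c0) => //.
  by have -> : (lam / c0 * c0 = lam)%R by [field; lra]; lra.
have le1 : (INR b.+1 <= exp (2 * ln (INR n)))%R by apply: INR_succ_le_exp.
have -> : ((/ lam) ^ q = exp (INR q * ln (/ lam)))%R.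
  by rewrite exp_mul_INR exp_ln //; apply: Rinv_0_lt_compat.
rewrite -!exp_plus.
apply: (@Rle_trans _ (exp (2 * ln (INR n)) * exp (INR q + INR q * ln (/ lam) +
   - (kappa * INR m) + INR n * (lam * y)))%R).
  by apply: Rmult_le_compat_r => //; apply/Rlt_le/exp_pos.
by rewrite -exp_plus; apply: exp_le_mono; lra.
Qed.

(** * From counts of bad sets to the proportion *)

Lemma good_indep_sets_sub n (H : hgraph n) Bn m :
  good_indep_sets H Bn m \subset indep_sets H m.
Proof. by apply/subsetP=> I; rewrite inE => /andP[]. Qed.

Lemma good_proportion_dist n (H : hgraph n) Bn m (e : R) :
  (0 <= e)%R ->
  (INR #|indep_sets H m| - INR #|good_indep_sets H Bn m| <= e * INR #|indep_sets H m|)%R ->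
  (Rdist (good_proportion H Bn m) 1 <= e)%R.
Proof.
move=> e0 bad; rewrite /Rdist /good_proportion.
have [_|/eqP ne0] := eqVneq #|indep_sets H m| 0.
  by rewrite Rminus_diag Rabs_R0.
have I0 : (0 < INR #|indep_sets H m|)%R by apply: lt_0_INR; lia.
have le_g := INR_leq (subset_leq_card (good_indep_sets_sub H Bn m)).
set I := INR _ in I0 le_g bad *; set g := INR _ in le_g bad *.
have Eq : (g / I * I = g)%R by field; lra.
have q1 : (g / I <= 1)%R by apply: (Rmult_le_reg_r I) => //; lra.
rewrite Rabs_left1; last lra.
by apply: (Rmult_le_reg_r I) => //; nra.
Qed.

Definition far_sets n (H : hgraph n) (Bn : {set {set 'I_n}}) m D : {set {set 'I_n}} :=
  [set I in indep_sets H m | [forall X in Bn, D < #|I :\: X|]].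

Lemma card_bad_le n (H : hgraph n) (Bn : {set {set 'I_n}}) (m D : nat) (M1 M2 : R) :
  (INR #|far_sets H Bn m D| <= M1)%R ->
  (forall X k, X \in Bn -> 0 < k -> k <= D ->
     (INR #|[set I in indep_sets H m | #|I :\: X| == k]| <= M2)%R) ->
  (INR #|indep_sets H m| - INR #|good_indep_sets H Bn m| <=
     M1 + INR #|Bn| * (INR D * M2))%R.
Proof.
move=> far near; set S := indep_sets H m in far near *.
(* The index [k < D] stands for [k.+1] vertices outside [X]; with none outside, [I] is good. *)
pose near_X X := \bigcup_(k : 'I_D) [set I in S | #|I :\: X| == k.+1].
have sub : S \subset good_indep_sets H Bn m :|:
    (far_sets H Bn m D :|: \bigcup_(X in Bn) near_X X).
  apply/subsetP=> I SI; rewrite !in_setU.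
  have [//|nG] := boolP (I \in good_indep_sets H Bn m).
  have [//|nF] := boolP (I \in far_sets H Bn m D).
  move: nF; rewrite inE SI negb_forall => /existsP[X].
  rewrite negb_imply -leqNgt => /andP[BX leD].
  have pos : 0 < #|I :\: X|.
    rewrite lt0n cards_eq0 setD_eq0; apply: contra nG => sIX.
    by rewrite inE SI; apply/existsP; exists X; rewrite BX.
  have lt : #|I :\: X|.-1 < D by rewrite prednK.
  apply/bigcupP; exists X => //; apply/bigcupP; exists (Ordinal lt) => //.
  by rewrite inE SI /= prednK.
have le := leq_trans (subset_leq_card sub) (leq_card_setU _ _).
have {}le := leq_trans le (leq_add (leqnn _) (leq_card_setU _ _)).
have := INR_leq le; rewrite !INR_addn => leR.
have nearR : (INR #|\bigcup_(X in Bn) near_X X| <= INR #|Bn| * (INR D * M2))%R.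
  apply: Rle_trans (INR_leq (card_bigcup_le _ _)) _; apply: INR_sum_le => X BX.
  apply: Rle_trans (INR_leq (card_bigcup_le _ _)) _.
  rewrite -[X in (_ <= INR X * _)%R](card_ord D); apply: INR_sum_le => k _.
  by apply: near => //; rewrite ltn_ord.
by lra.
Qed.

(** With [d] linear in [n], taking [tau] near [sqrt n] makes both [n * (tau + K) / d] and
    [n * K / tau] of order [sqrt n]. *)
Lemma fingerprint_size (n tau K d a1 a2 : nat) (e : R) :
  (0 < n)%N -> (0 < e)%R -> (e * INR n <= INR d)%R ->
  (sqrt (INR n) <= INR tau <= sqrt (INR n) + 1)%R ->
  (a1 * d <= n * (tau + K))%N -> (a2 * tau <= n * K)%N ->
  (INR (a1 + a2) <= (INR K + (2 + INR K) / e) * sqrt (INR n))%R.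
Proof.
move=> n0 e0 d_ge tau_s le1 le2.
have n1 : (1 <= INR n)%R by have := INR_leq n0; rewrite INR_1.
set s := sqrt (INR n) in tau_s *.
have s1 : (1 <= s)%R by rewrite -sqrt_1; apply: sqrt_le_1; lra.
have ss : (s * s = INR n)%R by apply: sqrt_sqrt; lra.
have K0 := pos_INR K; have a10 := pos_INR a1; have a20 := pos_INR a2.
have := INR_leq le1; have := INR_leq le2; rewrite !INR_muln !INR_addn => h2 h1.
have b2 : (INR a2 <= INR K * s)%R.
  apply: (Rmult_le_reg_r s); first lra.
  apply: (@Rle_trans _ (INR a2 * INR tau)%R); first by apply: Rmult_le_compat_l; lra.
  by apply: Rle_trans h2 _; rewrite -ss; right; ring.
have b1 : (INR a1 <= (2 + INR K) / e * s)%R.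
  apply: (Rmult_le_reg_r (e * INR n)); first by apply: Rmult_lt_0_compat; lra.
  apply: (@Rle_trans _ (INR a1 * INR d)%R); first by apply: Rmult_le_compat_l; lra.
  apply: Rle_trans h1 _.
  have -> : ((2 + INR K) / e * s * (e * INR n) = INR n * (2 * s + INR K * s))%R by field; lra.
  by apply: Rmult_le_compat_l; nra.
by lra.
Qed.

Lemma card_le_fam_norm n (Bn : {set {set 'I_n}}) X : X \in Bn -> #|X| <= fam_norm Bn.
Proof. by move=> BX; apply: (leq_bigmax_cond (F := fun X : {set 'I_n} => #|X|)). Qed.

Lemma fam_norm_le n (Bn : {set {set 'I_n}}) : fam_norm Bn <= n.
Proof.
apply/bigmax_leqP=> X _; rewrite -[X in _ <= X]card_ord; exact: max_card.
Qed.

Lemma Un_cv_of_dist (u : nat -> R) (l a : R) (N : nat) :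
  (forall n : nat, N <= n -> (Rdist (u n) l <= a / INR n)%R) -> Un_cv u l.
Proof.
move=> close e e0; have [N1 leN1] := eventually_le_INR (Rabs a / e + 1).
exists (maxn N N1).+1 => n /leP le_n.
have leN : (N <= n)%N by lia.
have leNN : (N1 <= n)%N by lia.
have n_ge := leN1 n leNN.
have ae : (0 <= Rabs a / e)%R by apply: Rle_mult_inv_pos => //; apply: Rabs_pos.
apply: Rle_lt_trans (close n leN) _.
apply: (Rmult_lt_reg_r (INR n)); first lra.
have -> : (a / INR n * INR n = a)%R by field; lra.
apply: Rle_lt_trans (Rle_abs a) _.
have E : (Rabs a = e * (Rabs a / e))%R by field; lra.
by rewrite E; apply: Rmult_lt_compat_l; lra.
Qed.

Theorem theorem2p2 (alpha : R) (H : forall n : nat, hgraph n)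
  (B : forall n : nat, {set {set 'I_n}}) :
  (0 < alpha < 1)%R ->
  (forall n, uniform3 (H n)) ->
  stable alpha H B ->
  (* e(H_n) = Theta(n^2) *)
  (exists c1 c2 : R, (0 < c1)%R /\ (0 < c2)%R /\ exists N : nat, forall n : nat, (N <= n)%N ->
     (c1 * INR n ^ 2 <= INR (nedges (H n)) <= c2 * INR n ^ 2)%R) ->
  (* Delta_2(H_n) = O(1) *)
  (exists K : nat, exists N : nat, forall n : nat, (N <= n)%N -> (Delta2 (H n) <= K)%N) ->
  (* |B_n| = n^{O(1)} *)
  (exists K : nat, exists N : nat, forall n : nat, (N <= n)%N -> (fam_card (B n) <= n ^ K)%N) ->
  (* alpha(H_n) >= ||B_n|| >= alpha n *)
  (forall n : nat, (fam_norm (B n) <= indep_number (H n))%N /\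
                   (alpha * INR n <= INR (fam_norm (B n)))%R) ->
  (* delta(H_n, B_n) = Omega(n) *)
  (exists c : R, (0 < c)%R /\ exists N : nat, forall n : nat, (N <= n)%N ->
     forall X v, X \in B n -> v \notin X -> (c * INR n <= INR (deg_into (H n) X v))%R) ->
  exists C : R, (0 < C)%R /\
    forall m : nat -> nat,
      (forall n : nat, (C * sqrt (INR n * ln (INR n)) <= INR (m n))%R) ->
      Un_cv (fun n => good_proportion (H n) (B n) (m n)) 1%R.
Proof.

(* Choice of the constants *)
move=> alpha01 H3 stab [c1 [c2 [c10 [_ [N1 edges]]]]] [K0 [N2 codeg]] [K2 [N3 famB]] norm
  [c [c_0 [N4 degB]]].
pose K := K0.+1; have K1 : (1 <= INR K)%R by rewrite S_INR; have := pos_INR K0; lra.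
(* This is the tolerance of [card_indep_escaping], and also the share of vertices that may be
   exposed while half of the cross edges survive. *)
pose eps := (c / (2 * INR K))%R.
have eps0 : (0 < eps)%R by apply: Rdiv_lt_0_compat; lra.
have [beta1 [beta10 stab1]] := stab eps eps0.
(* For [m > b - c0 * n], [c0 <= beta1] makes stability applicable and [c0 <= eps] contradicts
   [card_indep_escaping]; [c0 <= 1] keeps [ln (/ c0)] nonnegative. *)
pose c0 := Rmin 1 (Rmin beta1 eps).
have c01 : (0 < c0 <= 1)%R.
  by split; [repeat apply: Rmin_glb_lt => //; lra|apply: Rmin_l].
have c0b : (c0 <= beta1)%R by apply: Rle_trans (Rmin_r _ _) (Rmin_l _ _).
have c0e : (c0 <= eps)%R by apply: Rle_trans (Rmin_r _ _) (Rmin_r _ _).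
pose L0 := (1 + ln (/ c0))%R; have L01 : (1 <= L0)%R.
  by have := ln_inv_ge0 c01; rewrite /L0; lra.
(* [n ^ K2] pays for the choice of a member of [B n], one factor [n] for the number of outside
   vertices, and one is left over. *)
pose lc := (INR K2 + 2)%R; have lc0 : (2 <= lc)%R by have := pos_INR K2; rewrite /lc; lra.
pose delta := Rmin 1 (Rmin (eps / 256 * (eps / 256)) (eps / 128 / L0)).
have del0 : (0 < delta)%R.
  apply: Rmin_glb_lt; first lra; apply: Rmin_glb_lt.
    by apply: Rmult_lt_0_compat; lra.
  by apply: Rdiv_lt_0_compat; lra.
have del1 : (delta <= 1)%R by apply: Rmin_l.
have del2 : (delta <= eps / 256 * (eps / 256))%R by apply: Rle_trans (Rmin_r _ _) (Rmin_l _ _).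
have del3 : (delta * L0 <= eps / 128)%R.
  have := Rle_trans _ _ _ (Rmin_r _ _) (Rmin_r _ _) : (delta <= eps / 128 / L0)%R.
  move/(Rmult_le_compat_r L0 _ _ (Rle_trans _ _ _ Rle_0_1 L01)).
  by have -> : (eps / 128 / L0 * L0 = eps / 128)%R by field; lra.
have e10 : (0 < exp 1)%R := exp_pos 1.
(* Since [y <= m / (c0 * n)], this makes [exp 1 * y * gamma * n] at most [delta * m / 2]. *)
pose gamma := (delta * c0 / (2 * exp 1))%R.
have gam0 : (0 < gamma)%R.
  by apply: Rdiv_lt_0_compat; [apply: Rmult_lt_0_compat|]; lra.
have [beta2 [beta20 stab2]] := stab gamma gam0.
(* [delta / 2] is what remains for leaves close to a member; [beta2 / 2] suits small leaves, as
   [y / (1 + y) >= m / (2 * n)]. *)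
pose kappa := Rmin (delta / 2) (beta2 / 2).
have kap0 : (0 < kappa)%R by apply: Rmin_glb_lt; lra.
have kap1 : (kappa <= delta / 2)%R by apply: Rmin_l.
have kap2 : (kappa <= beta2 / 2)%R by apply: Rmin_r.
pose lam := Rmin 1 (kappa * c0 / 2).
have kc0 : (0 < kappa * c0)%R by apply: Rmult_lt_0_compat; lra.
have lam0 : (0 < lam)%R by apply: Rmin_glb_lt; lra.
have lam1 : (lam <= 1)%R by apply: Rmin_l.
have lam2 : (lam <= kappa * c0 / 2)%R by apply: Rmin_r.
have bc0 : (0 < beta2 * c1)%R by apply: Rmult_lt_0_compat.
pose e := (beta2 * c1 / 4)%R; have e0 : (0 < e)%R by rewrite /e; lra.
pose Q := (INR K + (2 + INR K) / e)%R.
have Q0 : (0 < Q)%R.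
  have : (0 < (2 + INR K) / e)%R by apply: Rdiv_lt_0_compat; lra.
  by rewrite /Q; lra.
have lnlam : (0 <= ln (/ lam))%R by apply: ln_inv_ge0.
(* Once [sqrt (ln n) >= z], the [Q * sqrt n] selections cost at most [kappa * m / 4]. *)
pose z := (4 / kappa * (Q * (1 + ln (/ lam))))%R.
have z0 : (0 < z)%R.
  by apply: Rmult_lt_0_compat; [apply: Rdiv_lt_0_compat|apply: Rmult_lt_0_compat]; lra.
have ec0 : (0 < eps * (c / (4 * INR K)))%R.
  by apply: Rmult_lt_0_compat => //; apply: Rdiv_lt_0_compat; lra.
pose C := (1 + 32 * (lc + 4) / (eps * (c / (4 * INR K))))%R.
have C1 : (1 <= C)%R.
  suff : (0 < 32 * (lc + 4) / (eps * (c / (4 * INR K))))%R by rewrite /C; lra.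
  by apply: Rdiv_lt_0_compat; lra.
have CC : (lc + 4 <= eps * (c / (4 * INR K)) * (C * C) / 32)%R.
  have -> : (lc + 4 = eps * (c / (4 * INR K)) * (C - 1) / 32)%R.
    by rewrite /C; field; lra.
  apply: Rmult_le_compat_r; first lra.
  by apply: Rmult_le_compat_l; nra.
exists C; split; first lra.
move=> m mC.

(* The bounds for a fixed large [n] *)
have [N5 big5] := eventually_le_INR (2 / eps).
have [N6 big6] := eventually_le_INR (4 / (beta2 * c1)).
have [N7 big7] := eventually_le_ln L0.
have [N8 big8] := eventually_ln_le_sqrt (64 * (lc + 2) / eps).
have [N9 big9] := eventually_ln_le_sqrt (12 / kappa).
have [N10 big10] := eventually_le_ln (z * z).
apply: (@Un_cv_of_dist _ _ 2 (N1 + N2 + N3 + N4 + N5 + N6 + N7 + N8 + N9 + N10).+1).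
move=> n le_n.
have {}edges : (c1 * INR n ^ 2 <= INR (nedges (H n)))%R by have [|] := edges n; first lia.
have {}codeg : Delta2 (H n) <= K by apply: leqW; apply: codeg; lia.
have {}famB : (INR #|B n| <= INR n ^ K2)%R.
  by rewrite -pow_INR; apply: INR_leq; apply: famB; lia.
have {}degB X v : X \in B n -> v \notin X -> (c * INR n <= INR (deg_into (H n) X v))%R.
  by apply: degB; lia.
have {}big5 : (2 / eps <= INR n)%R by apply: big5; lia.
have {}big6 : (4 / (beta2 * c1) <= INR n)%R by apply: big6; lia.
have {}big7 : (L0 <= ln (INR n))%R by apply: big7; lia.
have {}big8 : (64 * (lc + 2) / eps * ln (INR n) <= sqrt (INR n))%R by apply: big8; lia.
have {}big9 : (12 / kappa * ln (INR n) <= sqrt (INR n))%R by apply: big9; lia.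
have {}big10 : (z * z <= ln (INR n))%R by apply: big10; lia.
have n0 : 0 < n by lia.
have n1 : (1 <= INR n)%R by have := INR_leq n0; rewrite INR_1.
have {norm} [le_b b_ge] := norm n.
set b := fam_norm (B n) in le_b b_ge.
have le_bn : b <= n := fam_norm_le (B n).
have {}mC := mC n; move: (m n) mC => {}m mC.
have ln1 : (1 <= ln (INR n))%R by lra.
set s := sqrt (INR n) in big8 big9.
have s1 : (1 <= s)%R by rewrite -sqrt_1; apply: sqrt_le_1; lra.
have Esq : (sqrt (INR n * ln (INR n)) = s * sqrt (ln (INR n)))%R by apply: sqrt_mult; lra.
have sl1 : (1 <= sqrt (ln (INR n)))%R by rewrite -sqrt_1; apply: sqrt_le_1; lra.
have slz : (z <= sqrt (ln (INR n)))%R.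
  by rewrite -(sqrt_square z); [apply: sqrt_le_1; nra|lra].
have ms2 : (s * sqrt (ln (INR n)) <= INR m)%R.
  rewrite Esq in mC; have : (0 <= s * sqrt (ln (INR n)))%R by apply: Rmult_le_pos; lra.
  by move: mC; move: (s * _)%R => x ? ?; nra.
have m_s : (s <= INR m)%R.
  by apply: Rle_trans ms2; rewrite -{1}[s]Rmult_1_r; apply: Rmult_le_compat_l; lra.
have m0 : 0 < m by apply/ltP/INR_lt; rewrite INR_0; lra.
have mm : (C * C * (INR n * ln (INR n)) <= INR m * INR m)%R.
  have nl : (0 <= INR n * ln (INR n))%R by apply: Rmult_le_pos; lra.
  have sq0 := sqrt_pos (INR n * ln (INR n)).
  have Es := sqrt_sqrt _ nl; set S := sqrt _ in mC sq0 Es.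
  have CS : (0 <= C * S)%R by apply: Rmult_le_pos; lra.
  by rewrite -Es; have := Rmult_le_compat _ _ _ _ CS CS mC mC; lra.
have inv_n : (exp (- ln (INR n)) = / INR n)%R by rewrite exp_Ropp exp_ln //; lra.
(* Above [b - c0 * n] every independent set of size [m] is good, so the proportion is exactly
   [1]. *)
have [le_mb|gt_mb] := Rle_lt_dec (INR m + c0 * INR n) (INR b); last first.
  apply: good_proportion_dist; first by apply: Rle_mult_inv_pos; lra.
  suff -> : good_indep_sets (H n) (B n) m = indep_sets (H n) m.
    rewrite Rminus_diag; apply: Rmult_le_pos; last exact: pos_INR.
    by apply: Rle_mult_inv_pos; lra.
  apply/eqP; rewrite eqEsubset good_indep_sets_sub; apply/subsetP=> I SI.
  have := SI; rewrite inE => /andP[indI /eqP cardI].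
  rewrite inE SI; apply: contraT => /existsPn nG.
  have big : ((alpha - beta1) * INR n <= INR #|I|)%R.
    have : (c0 * INR n <= beta1 * INR n)%R by apply: Rmult_le_compat_r; lra.
    by rewrite cardI; lra.
  (* An independent set spans no edge while [H n] has some, which excludes the first alternative. *)
  have [edgeI|[X BX leX]] := stab1 n I big.
    have E0 : nedges_ind (H n) I = 0.
      apply/eqP; rewrite cards_eq0; apply/eqP/setP=> f; rewrite !inE.
      by apply/negP=> /andP[Hf]; apply/negP; apply: (forall_inP indI).
    move: edgeI; rewrite E0 INR_0.
    have : (0 < c1 * INR n ^ 2)%R by apply: Rmult_lt_0_compat => //; apply: pow_lt; lra.
    by nra.
  have nsub : ~~ (I \subset X) by have := nG X; rewrite BX.
  have := card_indep_escaping (H3 n) codeg (ltn0Sn _) (card_le_fam_norm BX)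
    (fun v => degB X v BX) indI nsub leX.
  have : (c0 * INR n <= eps * INR n)%R by apply: Rmult_le_compat_r; lra.
  by rewrite cardI -/b -/K -/eps; lra.
have lt_mb : m <= b.
  apply/leP/INR_le; have : (0 <= c0 * INR n)%R by apply: Rmult_le_pos; lra.
  by lra.
have c0bm : (c0 * INR n <= INR (b - m).+1)%R.
  by rewrite S_INR minus_INR; [lra|apply/leP].
set y := (INR m / INR (b - m).+1)%R.
have w0 : (0 < c0 * INR n)%R by apply: Rmult_lt_0_compat; lra.
have m0R : (0 < INR m)%R by lra.
have y0 : (0 < y)%R by apply: Rdiv_lt_0_compat; lra.
have y_le : (y * (c0 * INR n) <= INR m)%R.
  apply: (@Rle_trans _ (y * INR (b - m).+1)%R); first by apply: Rmult_le_compat_l; lra.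
  by right; rewrite /y; field; lra.
have p_ge : (INR m / (2 * INR n) <= y / (1 + y))%R := tilt_prob_ge m0 lt_mb le_bn.
have [D [D_le D_gt]] := @nat_floor (delta * INR m) (Rlt_le _ _ (Rmult_lt_0_compat _ _ del0 m0R)).
have [T [T_le T_gt]] := @nat_floor (eps * INR n) ltac:(nra).
(* The threshold used is [tau'.+1], so that it is at least [sqrt n]. *)
have [tau' [tau_le tau_gt]] := @nat_floor s ltac:(lra).
have [d [d_le d_gt]] := @nat_floor (beta2 * c1 * INR n / 2) ltac:(nra).
have [q [q_le q_gt]] := @nat_floor (Q * s) ltac:(nra).
have TK : (INR T * INR K <= c * INR n / 2)%R.
  have -> : (c * INR n / 2 = eps * INR n * INR K)%R by rewrite /eps; field; lra.
  by apply: Rmult_le_compat_r; lra.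
have T_ge : (eps * INR n / 2 <= INR T)%R.
  have : (2 <= eps * INR n)%R.
    have -> : (2 = eps * (2 / eps))%R by field; lra.
    by apply: Rmult_le_compat_l; lra.
  by lra.
have d_ge : (e * INR n <= INR d)%R.
  have : (4 <= beta2 * c1 * INR n)%R.
    have -> : (4 = beta2 * c1 * (4 / (beta2 * c1)))%R by field; lra.
    by apply: Rmult_le_compat_l; lra.
  by rewrite /e; lra.
set P := INR 'C(b, m).
have P0 : (0 <= P)%R by apply: pos_INR.
have far : (INR #|far_sets (H n) (B n) m D| <= P * exp (- ln (INR n)))%R.
  have tau_s : (s <= INR tau'.+1 <= s + 1)%R by rewrite S_INR; lra.
  have q_bound a1 a2 : a1 * d <= n * (tau'.+1 + K) -> a2 * tau'.+1 <= n * K -> a1 + a2 <= q.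
    move=> h1 h2; have := fingerprint_size n0 e0 d_ge tau_s h1 h2; rewrite -/Q -/s => h.
    by rewrite -ltnS; apply/ltP/INR_lt; rewrite S_INR; lra.
  (* [n * d] is below [beta2] times the number of edges, so the dense alternative fails; a set too
     small for stability is smaller than [alpha * n <= b] by [beta2 * n]. *)
  have leaf (A : {set 'I_n}) : nedges_ind (H n) A <= n * d ->
      (INR #|A| + beta2 * INR n <= INR b)%R \/
      exists2 X, X \in B n & (INR #|A :\: X| <= gamma * INR n)%R.
    move/INR_leq; rewrite INR_muln => few.
    have [bigA|smallA] := Rle_lt_dec ((alpha - beta2) * INR n) (INR #|A|); last by left; lra.
    have [many|] := stab2 n A bigA; last by right.
    exfalso.
    have n20 : (0 < INR n ^ 2)%R by apply: pow_lt; lra.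
    have : (beta2 * (c1 * INR n ^ 2) <= beta2 * INR (nedges (H n)))%R.
      by apply: Rmult_le_compat_l; lra.
    have : (INR n * INR d <= INR n * (beta2 * c1 * INR n / 2))%R.
      by apply: Rmult_le_compat_l; lra.
    have -> : (INR n * (beta2 * c1 * INR n / 2) = beta2 * c1 * INR n ^ 2 / 2)%R by field.
    have := Rmult_lt_0_compat _ _ bc0 n20; lra.
  have propF I : I \in far_sets (H n) (B n) m D -> [/\ independent (H n) I, #|I| = m &
      forall X, X \in B n -> (delta * INR m <= INR #|I :\: X|)%R].
    rewrite !inE => /andP[/andP[indI /eqP cardI] /forall_inP farI]; split=> // X BX.
    by have := INR_leq (farI X BX); rewrite S_INR; lra.
  have k1 : (kappa * INR m <= y / (1 + y) * (beta2 * INR n))%R.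
    apply: (@Rle_trans _ (INR m / (2 * INR n) * (beta2 * INR n))%R).
      have -> : (INR m / (2 * INR n) * (beta2 * INR n) = beta2 / 2 * INR m)%R by field; lra.
      by apply: Rmult_le_compat_r; lra.
    by apply: Rmult_le_compat_r => //; apply: Rmult_le_pos; lra.
  have k2 : (exp 1 * y * (gamma * INR n) + kappa * INR m <= delta * INR m)%R.
    have -> : (exp 1 * y * (gamma * INR n) = delta / 2 * (y * (c0 * INR n)))%R.
      by rewrite /gamma; field; lra.
    have : (delta / 2 * (y * (c0 * INR n)) <= delta / 2 * INR m)%R.
      by apply: Rmult_le_compat_l; lra.
    have : (kappa * INR m <= delta / 2 * INR m)%R by apply: Rmult_le_compat_r; lra.
    by lra.
  have leB X : X \in B n -> #|X| <= b by apply: card_le_fam_norm.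
  have lam01 : (0 < lam <= 1)%R by [].
  have beta20' : (0 <= beta2)%R by lra.
  apply: Rle_trans (card_far_sets (H3 n) codeg m0 lt_mb q_bound leaf leB propF lam01
    beta20' k1 k2) _.
  rewrite [(INR b.+1 * _)%R]Rmult_comm Rmult_assoc; apply: Rmult_le_compat_l => //.
  have qlam : (INR q * (1 + ln (/ lam)) <= kappa / 4 * INR m)%R.
    apply: (@Rle_trans _ (Q * s * (1 + ln (/ lam)))%R); first by apply: Rmult_le_compat_r; lra.
    have -> : (Q * s * (1 + ln (/ lam)) = kappa / 4 * (s * z))%R by rewrite /z; field; lra.
    apply: Rmult_le_compat_l; first lra.
    by apply: Rle_trans ms2; apply: Rmult_le_compat_l; lra.
  have ln12 : (12 * ln (INR n) <= kappa * INR m)%R.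
    have -> : (12 * ln (INR n) = kappa * (12 / kappa * ln (INR n)))%R by field; lra.
    by apply: Rmult_le_compat_l; lra.
  have c00 : (0 < c0)%R by lra.
  exact: (far_term n0 le_bn c0bm c00 lam0 lam2 ln1 qlam ln12).
have near X k : X \in B n -> 0 < k -> k <= D ->
    (INR #|[set I in indep_sets (H n) m | #|I :\: X| == k]| <= P * exp (- (lc * ln (INR n))))%R.
  move=> BX k0 kD.
  pose M := (INR b.+1 * P * (y ^ k * decay (y / (1 + y)) (c * INR k / (2 * INR K)) ^ T))%R.
  apply: (@Rle_trans _ (INR 'C(n, k) * M)%R).
    apply: card_near_sets => [U disU cardU|].
      have U0 : 0 < #|U| by rewrite cardU.
      have degU u : u \in U -> (c * INR n <= INR (deg_into (H n) X u))%R.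
        by move=> Uu; apply: degB BX _; rewrite (disjointFr disU Uu).
      have := card_sets_over (H3 n) codeg disU degU c_0 n0 (ltn0Sn _) U0 TK m0 lt_mb
        (card_le_fam_norm BX).
      by rewrite cardU.
    apply: Rmult_le_pos; first by apply: Rmult_le_pos; apply: pos_INR.
    apply: Rmult_le_pos; first by apply: pow_le; lra.
    have kk : (0 <= c * INR k / (2 * INR K))%R.
      apply: Rle_mult_inv_pos; last lra.
      by apply: Rmult_le_pos; [lra|apply: pos_INR].
    by have := decay_bounds (tilt_prob_bounds y0) kk => ?; apply: pow_le; lra.
  have -> : (INR 'C(n, k) * M = P * (INR 'C(n, k) * (INR b.+1 *
      (y ^ k * decay (y / (1 + y)) (c * INR k / (2 * INR K)) ^ T))))%R by rewrite /M; ring.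
  apply: Rmult_le_compat_l => //.
  have kDR : (INR k <= delta * INR m)%R by have := INR_leq kD; lra.
  have lc00 : (0 <= lc)%R by lra.
  have lnm : (64 * (lc + 2) / eps * ln (INR n) <= INR m)%R by lra.
  exact: (near_term k0 m0 lt_mb le_bn (ltn0Sn _) c0bm kDR c01 c_0 eps0 del0 lc00 T_ge
    del3 del2 mm CC big7 lnm).
apply: good_proportion_dist; first by apply: Rle_mult_inv_pos; lra.
apply: Rle_trans (card_bad_le far near) _.
have P_le : (P <= INR #|indep_sets (H n) m|)%R.
  by apply/INR_leq/bin_le_indep_sets.
(* Far sets and near sets each account for at most [P / n]. *)
apply: (@Rle_trans _ (2 / INR n * P)%R); last first.
  by apply: Rmult_le_compat_l => //; apply: Rle_mult_inv_pos; lra.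
have -> : (2 / INR n * P = P * / INR n + P * / INR n)%R by field; lra.
rewrite inv_n; apply: Rplus_le_compat_l.
have D_n : (INR D <= INR n)%R.
  have : (delta * INR m <= 1 * INR m)%R by apply: Rmult_le_compat_r; lra.
  by have := INR_leq lt_mb; have := INR_leq le_bn; lra.
have Elc : (exp (- (lc * ln (INR n))) = / (INR n ^ K2 * INR n * INR n))%R.
  rewrite exp_Ropp; congr (/ _)%R; rewrite /lc.
  have -> : ((INR K2 + 2) * ln (INR n) = INR K2 * ln (INR n) + ln (INR n) + ln (INR n))%R by ring.
  by rewrite !exp_plus exp_mul_INR !exp_ln //; lra.
have nK : (0 < INR n ^ K2)%R by apply: pow_lt; lra.
have e0' : (0 < exp (- (lc * ln (INR n))))%R := exp_pos _.
apply: (@Rle_trans _ (INR n ^ K2 * (INR n * (P * exp (- (lc * ln (INR n))))))%R).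
  have h0 : (0 <= P * exp (- (lc * ln (INR n))))%R by apply: Rmult_le_pos; lra.
  apply: Rmult_le_compat => //; first exact: pos_INR.
    by apply: Rmult_le_pos => //; apply: pos_INR.
  exact: Rmult_le_compat_r.
by right; rewrite Elc; field; lra.
Qed.
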